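(* (i) If weakly one-way functions exist, then strongly one-way functions exist. (ii) If weakly one-way permutations exist, then strongly one-way permutations exist.
   Context: A property of $n\in\mathbb{N}$ holds almost always (a.a.) if it holds for all sufficiently large $n$. For $F:\{0,1\}^*\to\{0,1\}^*$, the auxiliary function is $\overline{F}(x)=(1^{|x|},F(x))$. Let $X_n$ be uniform on $\{0,1\}^n$, $Y_n=F(X_n)$, and $R_n$ be uniform on $\{0,1\}^{q(n)}$, independent of $X_n$, for some polynomial $q$. A p.p.t. (probabilistic polynomial time) function $\overline{G}$ is a partial function $\overline{G}(1^n,y,r)$ computable in time polynomial in $|(1^n,y)|$, where $r\in\{0,1\}^{q(n)}$ supplies the random bits. $\mathbb{P}^n$ is the distribution of $(1^n,Y_n,R_n)$ and $I(1^n,y,r)=(1^n,y)$, so $\mathbb{P}^n\{\overline{F}\circ\overline{G}=I\}$ is the probability that $\overline{G}(1^n,Y_n,R_n)$ is defined and $\overline{F}(\overline{G}(1^n,Y_n,R_n))=(1^n,Y_n)$. A polynomial time computable $F:\{0,1\}^*\to\{0,1\}^*$ is a weakly one-way function if there is a $c>0$ such that for all p.p.t. $\overline{G}$, $\mathbb{P}^n\{\overline{F}\circ\overline{G}=I\}\le1-n^{-c}$ a.a.; it is a strongly one-way function if for all $c>0$ and all p.p.t. $\overline{G}$, $\mathbb{P}^n\{\overline{F}\circ\overline{G}=I\}\le n^{-c}$ a.a. If in addition $F$ restricts to a bijection of $\{0,1\}^n$ for every $n$, it is called a weakly (respectively strongly) one-way permutation. *)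

(* Defs.v *)
From HB Require Import structures.
From mathcomp Require Import all_boot all_order all_algebra.
From mathcomp Require Import all_classical all_reals all_analysis.

Set Implicit Arguments.
Unset Strict Implicit.
Unset Printing Implicit Defensive.

Import Order.TTheory GRing.Theory Num.Theory.

Local Open Scope classical_set_scope.
Local Open Scope ring_scope.

(** * Multi-tape Turing machines *)

(* Tape alphabet {0, 1, blank}; [None] is the blank. *)
Definition symbol := option bool.

Inductive move := MoveL | MoveN | MoveR.

(* A two-way infinite tape. The head scans the first cell of [rcells]; [lcells]
   lists the cells to the left of the head, nearest first. All the cells that
   are not listed are blank. *)
Record tape := Tape { lcells : seq symbol; rcells : seq symbol }.

Definition scanned (t : tape) : symbol := head None (rcells t).

Definition write_move (t : tape) (a : symbol * move) : tape :=
  let: Tape ls rs := t in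
  let rs' := a.1 :: behead rs in
  match a.2 with
  | MoveL => Tape (behead ls) (head None ls :: rs')
  | MoveN => Tape ls rs'
  | MoveR => Tape (a.1 :: ls) (behead rs)
  end.

Definition tape_of_word (w : bitseq) : tape := Tape [::] (map Some w).

(* The word read from the head up to, and excluding, the first blank. *)
Fixpoint word_of_cells (s : seq symbol) : bitseq :=
  if s is Some b :: s' then b :: word_of_cells s' else [::].

Definition word_of_tape (t : tape) : bitseq := word_of_cells (rcells t).

(* A deterministic machine with [tm_extra.+1] tapes. It halts upon reaching a
   state in [tm_halting]; [tm_accepting] is relevant for those states only, the
   other halting states being the rejecting ones. *)
Record machine := Machine {
  tm_extra : nat;
  tm_state : finType;
  tm_start : tm_state;
  tm_halting : pred tm_state;
  tm_accepting : pred tm_state;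
  tm_next : tm_state -> tm_extra.+1.-tuple symbol ->
            tm_state * tm_extra.+1.-tuple (symbol * move)
}.

Section Execution.
Variable M : machine.

Definition config := (tm_state M * (tm_extra M).+1.-tuple tape)%type.

(* The input words are on the first tapes, one word per tape. *)
Definition initial (ws : seq bitseq) : config :=
  (tm_start M, [tuple tape_of_word (nth [::] ws i) | i < (tm_extra M).+1]).

Definition step (c : config) : config :=
  if tm_halting c.1 then c else
  let sa := tm_next c.1 (map_tuple scanned c.2) in
  (sa.1, [tuple write_move (tnth c.2 i) (tnth sa.2 i) | i < (tm_extra M).+1]).

(* The output is on the first tape; a rejecting machine has no output. *)
Definition output (c : config) : option bitseq :=
  if tm_accepting c.1 then Some (word_of_tape (tnth c.2 ord0)) else None.

Definition computes_within (t : nat) (ws : seq bitseq) (o : option bitseq) :=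
  let c := iter t step (initial ws) in tm_halting c.1 /\ output c = o.

End Execution.

(** * Polynomial time *)

Definition poly_time (F : bitseq -> bitseq) : Prop :=
  exists (M : machine) (p : {poly nat}), forall x : bitseq,
    computes_within M p.[size x] [:: x] (Some (F x)).

Definition ones (n : nat) : bitseq := nseq n true.

(* A partial function is an [option]-valued one. It is computed by a machine
   that always halts in polynomial time, and rejects the arguments at which the
   function is undefined. The random bits [r] do not count in the size of the
   argument. *)
Definition ppt (q : {poly nat}) (G : bitseq * bitseq * bitseq -> option bitseq)
  : Prop :=
  exists (M : machine) (p : {poly nat}), forall (n : nat) (y r : bitseq),
    size r = q.[n] ->
    computes_within M p.[(n + size y)%N] [:: ones n; y; r] (G (ones n, y, r)).

(** * One-way functions *)

Section OneWay.
Variable R : realType.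
Implicit Types (F : bitseq -> bitseq).

Definition auxiliary F (x : bitseq) : bitseq * bitseq := (ones (size x), F x).

Definition equiprobability (T : finType) (E : pred T) : R := #|E|%:R / #|T|%:R.

(* The law of (1^n, F X_n, R_n), where (X_n, R_n) is uniform on
   {0,1}^n x {0,1}^q(n), i.e. X_n and R_n are uniform and independent. *)
Definition challenge_prob F (q : {poly nat}) (n : nat)
    (E : pred (bitseq * bitseq * bitseq)) : R :=
  equiprobability [pred xr : n.-tuple bool * (q.[n]).-tuple bool |
                E (ones n, F xr.1, tval xr.2)].

Definition inverts F (G : bitseq * bitseq * bitseq -> option bitseq)
    : pred (bitseq * bitseq * bitseq) :=
  [pred w | omap (auxiliary F) (G w) == Some w.1].

Definition weakly_one_way F : Prop :=
  poly_time F /\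
  exists c : R, 0 < c /\
    forall (q : {poly nat}) G, ppt q G ->
      \forall n \near \oo,
        challenge_prob F q n (inverts F G) <= 1 - n%:R `^ (- c).

Definition strongly_one_way F : Prop :=
  poly_time F /\
  forall c : R, 0 < c ->
    forall (q : {poly nat}) G, ppt q G ->
      \forall n \near \oo,
        challenge_prob F q n (inverts F G) <= n%:R `^ (- c).

Definition length_permutation F : Prop :=
  forall n : nat,
    set_bij [set x | size x = n] [set x | size x = n] F.

Definition weakly_one_way_permutation F : Prop :=
  weakly_one_way F /\ length_permutation F.

Definition strongly_one_way_permutation F : Prop :=
  strongly_one_way F /\ length_permutation F.

End OneWay.

(* Main.v *)
Require Import Defs.
From mathcomp Require Import all_boot all_order all_algebra.
From mathcomp Require Import all_classical all_reals all_analysis.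
From mathcomp Require Import zify ring lra.

(* Yao's amplification. Put F'(x_1 ... x_m tail) = F(x_1) ... F(x_m) tail, where the
   x_i are m = n^(k+1) blocks of length n = floor(N^(1/(k+2))), N being the input
   length, and the words F(x_i) are made self-delimiting unless F is a permutation.
   Let G invert F' with probability alpha at the length N, and let B be the set of
   the x such that, for every i, G inverts F' with probability at most eps when the
   i-th block is x and the rest is random. If beta is the density of B, then
   alpha <= (1 - beta)^m + m eps. Conversely, inverting F(x) by submitting to G its
   challenges with F(x) hidden at each position, S times each, succeeds with
   probability at least (1 - beta)(1 - (1 - eps)^S). As F is weakly one-way, beta is
   at least about n^-k, and then alpha is smaller than any given n^-D.

   On the computational side, the functions between types encoded as tuples of words
   that are computed by polynomial time register programs are closed under
   composition, pairing, case analysis and iteration with polynomially bounded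
   intermediate values; one step of a Turing machine is such a function, and
   conversely register programs are compiled to Turing machines, tapes being used
   as stacks. *)

Set Implicit Arguments.
Unset Strict Implicit.
Unset Printing Implicit Defensive.

Local Open Scope nat_scope.

(** * A while language on word registers, compiled to Turing machines *)

(** The strong bound is claimed at each large length [N] separately, and [G] may do well at only
    some of the lengths that share the root [n]. The inverter of [F] sees [n] alone; it therefore
    tries every possible tail length, and the analysis keeps the one that corresponds to [N]. Wrong
    guesses are harmless: since [F] is computable, a candidate is checked before it is returned, and
    one success among all the trials is enough. Quantifying over all positions in the definition of
    B avoids any conditioning. An inverted challenge either has no block in B, which has probability
    (1 - beta)^m by independence, or has a block in B at some position, and each position
    contributes at most eps. The number of blocks exceeds the inverse of the density of B by a
    factor of order n, so the first term decays exponentially in n; as [N] is at most a fixed power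
    of n, any power of [N] is beaten. Self-delimitation is what lets a preimage of the whole be cut
    into preimages of the blocks; it lengthens the words, which a permutation of {0,1}^N does not
    permit. *)

Definition store := nat -> bitseq.
Definition upd (s : store) r w : store := fun i => if i == r then w else s i.

Definition branch (T : Type) (w : bitseq) (x0 x1 x2 : T) : T :=
  match w with [::] => x0 | false :: _ => x1 | true :: _ => x2 end.

Inductive cmd :=
| Skip
| Push of nat & bool
| Pop of nat
| Seq of cmd & cmd
| Branch of nat & cmd & cmd & cmd
| While of nat & cmd.

(* The third argument is the exact number of steps of the compiled code. *)
Inductive exec : cmd -> store -> nat -> store -> Prop :=
| exec_Skip s : exec Skip s 0 s
| exec_Push r b s : exec (Push r b) s 2 (upd s r (b :: s r))
| exec_Pop r s : exec (Pop r) s 1 (upd s r (behead (s r)))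
| exec_Seq c1 c2 s1 t1 s2 t2 s3 :
    exec c1 s1 t1 s2 -> exec c2 s2 t2 s3 -> exec (Seq c1 c2) s1 (t1 + t2) s3
| exec_Branch r c0 c1 c2 s t s' :
    exec (branch (s r) c0 c1 c2) s t s' -> exec (Branch r c0 c1 c2) s t.+2 s'
| exec_While_nil r c s : s r = [::] -> exec (While r c) s 1 s
| exec_While_cons r c s1 t1 s2 t2 s3 : s1 r <> [::] ->
    exec c s1 t1 s2 -> exec (While r c) s2 t2 s3 ->
    exec (While r c) s1 (t1.+2 + t2) s3.

Inductive instr :=
| Act of nat & (symbol -> symbol) & move
| Jump of nat & nat & nat & nat.

Fixpoint code_size (c : cmd) : nat :=
  match c with
  | Skip => 0
  | Push _ _ => 2
  | Pop _ => 1
  | Seq c1 c2 => code_size c1 + code_size c2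
  | Branch _ c0 c1 c2 => (code_size c0).+1 + ((code_size c1).+1 + (code_size c2).+1) + 1
  | While _ c => (code_size c).+2
  end.

(** The address [o] of the first instruction is an argument because jumps are absolute. A jump with
    three equal targets is unconditional. The top of a register being under the head, a push steps
    left and then writes over whatever stands there. *)
Fixpoint code_of (c : cmd) (o : nat) : seq instr :=
  match c with
  | Skip => [::]
  | Push r b => [:: Act r id MoveL; Act r (fun=> Some b) MoveN]
  | Pop r => [:: Act r (fun=> None) MoveR]
  | Seq c1 c2 => code_of c1 o ++ code_of c2 (o + code_size c1)
  | Branch r c0 c1 c2 =>
      let o1 := (o.+1 + code_size c0).+1 in
      let o2 := (o1 + code_size c1).+1 in
      let e := (o2 + code_size c2).+1 in
      Jump r o.+1 o1 o2 :: code_of c0 o.+1 ++ Jump 0 e e e ::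
        code_of c1 o1 ++ Jump 0 e e e :: code_of c2 o2 ++ [:: Jump 0 e e e]
  | While r c =>
      let e := (o + code_size c).+2 in
      Jump r e o.+1 o.+1 :: code_of c o.+1 ++ [:: Jump 0 o o o]
  end.

Lemma size_code_of c o : size (code_of c o) = code_size c.
Proof.
elim: c o => //= [c1 IH1 c2 IH2|r c0 IH0 c1 IH1 c2 IH2|r c IH] o;
  rewrite ?size_cat /= ?size_cat /= ?size_cat /= ?IH0 ?IH1 ?IH2 ?IH /=; lia.
Qed.

Fixpoint max_reg (c : cmd) : nat :=
  match c with
  | Skip => 0
  | Push r _ | Pop r => r
  | Seq c1 c2 => maxn (max_reg c1) (max_reg c2)
  | Branch r c0 c1 c2 => maxn r (maxn (max_reg c0) (maxn (max_reg c1) (max_reg c2)))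
  | While r c => maxn r (max_reg c)
  end.

Definition pick_jump (a : symbol) (j0 j1 j2 : nat) : nat :=
  match a with None => j0 | Some false => j1 | Some true => j2 end.

Section Compile.
Variables (K : nat) (P : seq instr).

Definition instr_next (q : 'I_(size P).+2) (v : K.+1.-tuple symbol) :
    'I_(size P).+2 * K.+1.-tuple (symbol * move) :=
  match nth (Jump 0 0 0 0) P q with
  | Act r f mv =>
      (inord q.+1, [tuple if val i == r then (f (tnth v i), mv) else (tnth v i, MoveN)
                    | i < K.+1])
  | Jump r j0 j1 j2 =>
      (inord (pick_jump (nth None v r) j0 j1 j2), [tuple (tnth v i, MoveN) | i < K.+1])
  end.

(** The state is the program counter. The two addresses past the end of [P] are the halting states:
    [size P] accepts, [(size P).+1] rejects. *)
Definition code_machine : machine :=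
  @Machine K 'I_(size P).+2 ord0 (fun q => size P <= q) (fun q => val q == size P)
    instr_next.

(** Nothing is asked of the cells to the left, since a push overwrites the one it reaches. Trailing
    blanks are allowed because an idle step on an exhausted tape writes its blank explicitly. *)
Definition holds (t : tape) (w : bitseq) :=
  exists j, rcells t = map Some w ++ nseq j None.

Lemma holds_scanned t w : holds t w -> scanned t = ohead w.
Proof. by rewrite /scanned; case=> j ->; case: w => //=; case: j. Qed.

Lemma holds_idle t w : holds t w -> holds (write_move t (scanned t, MoveN)) w.
Proof.
case: t => ls rs [j /= ->]; case: w => [|b w] /=; last by exists j.
by exists j.-1.+1; case: j.
Qed.

Lemma holds_pop t w a : holds t w -> holds (write_move t (a, MoveR)) (behead w).
Proof.
case: t => ls rs [j /= ->]; case: w => [|b w] /=; last by exists j.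
by exists j.-1; case: j.
Qed.

Lemma holds_push t w b : holds t w ->
  holds (write_move (write_move t (scanned t, MoveL)) (Some b, MoveN)) (b :: w).
Proof.
case: t => ls rs [j /= ->]; case: w => [|b' w] /=; last by exists j.
by exists j.-1.+1; case: j.
Qed.

Definition matches (cf : config code_machine) (pc : nat) (s : store) :=
  [/\ nat_of_ord cf.1 = pc & forall i : 'I_K.+1, holds (tnth cf.2 i) (s i)].

Lemma step_act (q : 'I_(size P).+2) ts r f mv :
  nth (Jump 0 0 0 0) P q = Act r f mv -> q < size P ->
  let cf := step ((q, ts) : config code_machine) in
  nat_of_ord cf.1 = q.+1 /\
  forall i : 'I_K.+1, tnth cf.2 i = if val i == r
    then write_move (tnth ts i) (f (scanned (tnth ts i)), mv)
    else write_move (tnth ts i) (scanned (tnth ts i), MoveN).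
Proof.
move=> Eq lt_q; rewrite /step /= leqNgt lt_q /= /instr_next Eq /=.
split=> [|i]; first by rewrite inordK // !ltnS ltnW.
by rewrite !tnth_mktuple; case: ifP; rewrite tnth_map.
Qed.

Lemma step_jump cf s r j0 j1 j2 pc : nth (Jump 0 0 0 0) P pc = Jump r j0 j1 j2 ->
  pc < size P -> r <= K -> maxn j0 (maxn j1 j2) <= (size P).+1 -> matches cf pc s ->
  matches (step cf) (branch (s r) j0 j1 j2) s.
Proof.
case: cf => q ts Eq lt_pc le_r lt_j [/= Epc Hts].
rewrite /step /= Epc leqNgt lt_pc /= /instr_next Epc Eq /=.
split=> [|i] /=; last first.
  by rewrite !tnth_mktuple tnth_map; apply: holds_idle.
have -> : nth None [seq scanned i | i <- ts] r = ohead (s r).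
  rewrite (nth_map (tnth ts ord0)) ?size_tuple ?ltnS //.
  have := Hts (inord r); rewrite (tnth_nth (tnth ts ord0)) inordK ?ltnS //.
  exact: holds_scanned.
by rewrite inordK; case: (s r) => [|[] w] /=; lia.
Qed.

(** Induction on the execution, with the code in an arbitrary context, as the pieces of a compound
    command occur at shifted addresses. The time in [exec] being exact, [iter t] stops precisely at
    the end of the code. *)
Lemma code_correct c s t s' : exec c s t s' -> max_reg c <= K ->
  forall pre post cf, P = pre ++ code_of c (size pre) ++ post ->
  matches cf (size pre) s ->
  matches (iter t (@step _) cf) (size pre + code_size c) s'.
Proof.
have nthP i0 pre (l : seq instr) post : i0 < size l ->
    nth (Jump 0 0 0 0) (pre ++ l ++ post) (size pre + i0) = nth (Jump 0 0 0 0) l i0.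
  by move=> lt_i; rewrite nth_cat ltnNge leq_addr /= addKn nth_cat lt_i.
have nthJ (pre l : seq instr) i : nth (Jump 0 0 0 0) (pre ++ i :: l) (size pre) = i.
  by rewrite nth_cat ltnn subnn.
have catE := (fun a b c : seq instr => esym (catA a b c),
  fun (x : instr) a b => erefl : (x :: a) ++ b = x :: (a ++ b)).
have szE := (size_cat, size_code_of,
    fun (x : instr) l => erefl : size (x :: l) = (size l).+1,
    erefl : size ([::] : seq instr) = 0).
elim=> {c s t s'}.
- by move=> s _ pre post cf _ /=; rewrite addn0.
- move=> r b s le_r pre post [q ts] EP /= [/= Epc Hts].
  have szP : size pre + 2 <= size P by rewrite EP !size_cat /=; lia.
  have E0 : nth (Jump 0 0 0 0) P (nat_of_ord q) = Act r id MoveL.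
    by rewrite Epc EP nthJ.
  have [|] := step_act ts E0; first by rewrite Epc; lia.
  case: (step _) => q1 ts1 /= Eq1 Hts1.
  have E1 : nth (Jump 0 0 0 0) P (nat_of_ord q1) = Act r (fun=> Some b) MoveN.
    by rewrite /= Eq1 Epc EP -addn1 nthP.
  have [|] := step_act ts1 E1; first by rewrite /= Eq1 Epc; lia.
  case: (step _) => q2 ts2 /= Eq2 Hts2.
  split=> [|i] /=; first by rewrite Eq2 Eq1 Epc addn2.
  rewrite Hts2 Hts1 /upd; case: eqP => [<-|_]; first exact: holds_push.
  by apply/holds_idle/holds_idle.
- move=> r s le_r pre post [q ts] EP /= [/= Epc Hts].
  have szP : size pre + 1 <= size P by rewrite EP !size_cat /=; lia.
  have E0 : nth (Jump 0 0 0 0) P (nat_of_ord q) = Act r (fun=> None) MoveR.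
    by rewrite Epc EP nthJ.
  have [|] := step_act ts E0; first by rewrite Epc; lia.
  case: (step _) => q1 ts1 /= Eq1 Hts1.
  split=> [|i] /=; first by rewrite Eq1 Epc addn1.
  rewrite Hts1 /upd; case: eqP => [<-|_]; first exact: holds_pop.
  exact: holds_idle.
- move=> c1 c2 s1 t1 s2 t2 s3 _ IH1 _ IH2 /= le_r pre post cf EP Hcf.
  rewrite [t1 + t2]addnC iterD addnA.
  have {}IH1 := IH1 _ pre (code_of c2 (size pre + code_size c1) ++ post) cf.
  have := IH2 _ (pre ++ code_of c1 (size pre)) post (iter t1 (@step _) cf).
  rewrite size_cat size_code_of; apply=> //; first lia.
    by rewrite EP ?catE.
  by apply: IH1 => //; [lia|rewrite EP ?catE].
- move=> r c0 c1 c2 s t s' _ IH /= le_r pre post cf EP Hcf.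
  move: EP; set o1 := (_ + code_size c0).+1; set o2 := (_ + code_size c1).+1.
  set e := (_ + code_size c2).+1 => EP.
  have szP : e <= size P.
    by rewrite EP !szE /e /o2 /o1; lia.
  rewrite -[X in step X]iterS iterSr.
  have H0 : matches (step cf) (branch (s r) (size pre).+1 o1 o2) s.
    apply: (step_jump _ _ _ _ Hcf); try (rewrite /e /o2 /o1 in szP *; lia).
    by rewrite EP nthJ.
  (* Each alternative ends with an unconditional jump to the common exit [e]: this is the second of
     the two extra steps in [exec_Branch]. *)
  have fin cf' pc s0 : nth (Jump 0 0 0 0) P pc = Jump 0 e e e -> pc < size P ->
      matches cf' pc s0 -> matches (step cf') e s0.
    move=> E lt_pc H; have := step_jump E lt_pc (leq0n K) _ H.
    by case: (s0 0) => [|[] w] /=; apply; lia.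
  have -> : size pre + ((code_size c0).+1 + ((code_size c1).+1 + (code_size c2).+1) + 1) = e.
    by rewrite /e /o2 /o1; lia.
  case Er : (s r) IH H0 => [|[] w] /= IH H0.
  + apply: (fin _ ((size pre).+1 + code_size c0)).
    * by rewrite EP nth_cat ifN; [|lia];
        rewrite addSn subSn ?leq_addr // addKn /= ?catE nth_cat size_code_of ltnn subnn.
    * by rewrite /e /o2 /o1 in szP; lia.
    * have := IH _ (pre ++ [:: Jump r (size pre).+1 o1 o2]) _ (step cf).
      rewrite size_cat /= addn1; apply=> //; first lia.
      by rewrite EP ?catE.
  + apply: (fin _ (o2 + code_size c2)).
    * rewrite EP -[RHS]/(nth (Jump 0 0 0 0) [:: Jump 0 e e e] 0).
      pose L := pre ++ (Jump r (size pre).+1 o1 o2 :: code_of c0 (size pre).+1 ++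
        Jump 0 e e e :: code_of c1 o1 ++ Jump 0 e e e :: code_of c2 o2).
      have -> : o2 + code_size c2 = size L + 0.
        by rewrite /L !szE /o2 /o1; lia.
      by rewrite -(nthP 0 L [:: Jump 0 e e e] post) // /L ?catE.
    * by rewrite /e /o2 /o1 in szP; lia.
    * have := IH _ (pre ++ Jump r (size pre).+1 o1 o2 :: code_of c0 (size pre).+1 ++
        Jump 0 e e e :: code_of c1 o1 ++ [:: Jump 0 e e e]) _ (step cf).
      have -> : size (pre ++ Jump r (size pre).+1 o1 o2 :: code_of c0 (size pre).+1 ++
        Jump 0 e e e :: code_of c1 o1 ++ [:: Jump 0 e e e]) = o2.
        by rewrite !szE /o2 /o1; lia.
      apply=> //; first lia.
      by rewrite EP ?catE.
  + apply: (fin _ (o1 + code_size c1)).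
    * rewrite EP -[RHS]/(nth (Jump 0 0 0 0) [:: Jump 0 e e e] 0).
      pose L := pre ++ (Jump r (size pre).+1 o1 o2 :: code_of c0 (size pre).+1 ++
        Jump 0 e e e :: code_of c1 o1).
      have -> : o1 + code_size c1 = size L + 0.
        by rewrite /L !szE /o1; lia.
      rewrite -(nthP 0 L [:: Jump 0 e e e] (code_of c2 o2 ++ [:: Jump 0 e e e] ++ post)) //.
      by rewrite /L ?catE.
    * by rewrite /e /o2 /o1 in szP; lia.
    * have := IH _ (pre ++ Jump r (size pre).+1 o1 o2 :: code_of c0 (size pre).+1 ++
        [:: Jump 0 e e e]) _ (step cf).
      have -> : size (pre ++ Jump r (size pre).+1 o1 o2 :: code_of c0 (size pre).+1 ++
        [:: Jump 0 e e e]) = o1.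
        by rewrite !szE /o1; lia.
      apply=> //; first lia.
      by rewrite EP ?catE.
- move=> r c s Er /= le_r pre post cf EP Hcf.
  have szP : (size pre + code_size c).+2 <= size P.
    by rewrite EP !szE; lia.
  have -> : size pre + (code_size c).+2 = (size pre + code_size c).+2 by lia.
  have := step_jump _ _ _ _ Hcf; rewrite EP.
  move=> /(_ r (size pre + code_size c).+2 (size pre).+1 (size pre).+1).
  rewrite Er /=; apply; try (rewrite -?EP; lia).
  by rewrite nthJ.
- move=> r c s1 t1 s2 t2 s3 Er _ IH1 _ IH2 le_r pre post cf EP Hcf.
  rewrite /= in EP le_r.
  have szP : (size pre + code_size c).+2 <= size P.
    by rewrite EP !szE; lia.
  rewrite [t1.+2 + t2]addnC iterD iterS iterSr.
  apply: (IH2 _ pre post) => //.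
  have H0 : matches (step cf) (size pre).+1 s1.
    have := step_jump _ _ _ _ Hcf; rewrite EP.
  move=> /(_ r (size pre + code_size c).+2 (size pre).+1 (size pre).+1).
    have -> : branch (s1 r) (size pre + code_size c).+2 (size pre).+1 (size pre).+1 = (size pre).+1.
      by case: (s1 r) Er => [|[]].
    apply; try (rewrite -?EP; lia).
    by rewrite nthJ.
  have H1 : matches (iter t1 (@step _) (step cf)) ((size pre).+1 + code_size c) s2.
    have := IH1 _ (pre ++ [:: Jump r (size pre + code_size c).+2 (size pre).+1 (size pre).+1])
      _ (step cf).
    rewrite size_cat /= addn1; apply=> //; first lia.
    by rewrite EP ?catE.
  have := step_jump _ _ _ _ H1; move=> /(_ 0 (size pre) (size pre) (size pre)).
  have -> : branch (s2 0) (size pre) (size pre) (size pre) = size pre by case: (s2 0) => [|[]].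
  apply; try lia.
  by rewrite EP nth_cat ifN; [|lia];
        rewrite addSn subSn ?leq_addr // addKn /= ?catE nth_cat size_code_of ltnn subnn.
Qed.

End Compile.

Lemma word_of_tape_holds t w : holds t w -> word_of_tape t = w.
Proof.
rewrite /word_of_tape; case=> j ->; elim: w => [|b w IH] /=; first by case: j.
by rewrite IH.
Qed.

Lemma machine_of_cmd (c : cmd) : exists M : machine, forall ws t s',
  exec c (nth [::] ws) t s' ->
  computes_within M t.+1 ws (if s' 1 is true :: _ then Some (s' 0) else None).
Proof.
pose n := code_size c; pose K := maxn 1 (max_reg c).
pose P := code_of c 0 ++ [:: Jump 1 n.+2 n.+2 n.+1].
have szP : size P = n.+1 by rewrite size_cat size_code_of addn1.
exists (code_machine K P) => ws t s' Hc; rewrite /computes_within.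
have H0 : matches (@initial (code_machine K P) ws) 0 (nth [::] ws).
  by split=> // i; rewrite tnth_mktuple; exists 0; rewrite cats0.
have H1 : matches (iter t (@step _) (@initial (code_machine K P) ws)) n s'.
  exact: (@code_correct K P c _ t s' Hc (leq_maxr _ _) [::]
    [:: Jump 1 n.+2 n.+2 n.+1] _ erefl H0).
have := step_jump _ _ _ _ H1; move=> /(_ 1 n.+2 n.+2 n.+1 _ _ _ _).
rewrite -iterS; case: (iter _ _ _) => q ts.
case=> [||||Eq Hts] /=.
- by rewrite nth_cat size_code_of ltnn subnn.
- by rewrite szP.
- exact: leq_maxl.
- by rewrite szP; lia.
- rewrite /output /= in Eq *; rewrite Eq szP (word_of_tape_holds (Hts ord0)).
  by case: (s' 1) => [|[] w] /=; rewrite ?eqxx; split=> //; try case: eqP => //; lia.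
Qed.

(** * Polynomial bounds *)

(** As the base is at least 2, such powers absorb constants, sums, products and compositions, and a
    single exponent describes a bound. *)
Definition pb (k w : nat) : nat := w.+2 ^ k.

Definition polyb (g : nat -> nat) : Prop := exists k, forall w, g w <= pb k w.

Lemma leq_expl m n e : m <= n -> m ^ e <= n ^ e.
Proof. by case: e => // e le_mn; rewrite leq_exp2r. Qed.

Lemma pb_gt0 k w : 0 < pb k w. Proof. by rewrite expn_gt0. Qed.

Lemma pb_mono k k' w w' : k <= k' -> w <= w' -> pb k w <= pb k' w'.
Proof.
move=> le_k le_w; apply: leq_trans (leq_pexp2l _ le_k) => //.
exact: leq_expl.
Qed.

Lemma pb_monor k w w' : w <= w' -> pb k w <= pb k w'.
Proof. exact: pb_mono. Qed.

Lemma polyb_le g g' : (forall w, g w <= g' w) -> polyb g' -> polyb g.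
Proof. by move=> le_g [k Hk]; exists k => w; apply: leq_trans (le_g w) (Hk w). Qed.

Lemma polyb_const c : polyb (fun=> c).
Proof.
exists c => w; apply: leq_trans (ltnW (ltn_expl c (isT : 1 < 2))) _.
exact: leq_expl.
Qed.

Lemma polyb_id : polyb id.
Proof. by exists 1 => w; rewrite /pb expn1 ltnW. Qed.

Lemma polybD g g' : polyb g -> polyb g' -> polyb (fun w => g w + g' w).
Proof.
move=> [k Hk] [k' Hk']; exists (k + k').+1 => w.
have h : pb (k + k') w + pb (k + k') w <= pb (k + k').+1 w.
  by rewrite /pb expnS addnn -mul2n leq_mul2r; lia.
apply: leq_trans h; apply: leq_add.
  by apply: leq_trans (Hk w) _; apply: pb_mono; rewrite ?leq_addr.
by apply: leq_trans (Hk' w) _; apply: pb_mono; rewrite ?leq_addl.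
Qed.

Lemma polybM g g' : polyb g -> polyb g' -> polyb (fun w => g w * g' w).
Proof.
move=> [k Hk] [k' Hk']; exists (k + k') => w.
by rewrite /pb expnD leq_mul ?Hk ?Hk'.
Qed.

Lemma polyb_pb k g : polyb g -> polyb (fun w => pb k (g w)).
Proof.
move=> [l Hl]; exists (l.+2 * k) => w; rewrite /pb expnM; apply: leq_expl.
apply: leq_trans (_ : (pb l w).+2 <= _); first exact: Hl.
have := pb_gt0 l w; rewrite /pb !expnS; set e := _ ^ l => e_gt0.
by nia.
Qed.

#[local] Hint Resolve polyb_const polyb_id polybD polybM polyb_pb : polyb.

Lemma polybS g : polyb g -> polyb (fun w => (g w).+1).
Proof.
by move=> H; apply: polyb_le (polybD H (polyb_const 1)) => w; rewrite addn1.
Qed.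
#[local] Hint Resolve polybS : polyb.

(** * Register programs *)

Definition bexec c s T s' := exists2 t, t <= T & exec c s t s'.

Lemma bexec_le c s T T' s' : T <= T' -> bexec c s T s' -> bexec c s T' s'.
Proof. by move=> le_T [t le_t H]; exists t => //; apply: leq_trans le_T. Qed.

Lemma bexec_Seq c1 c2 s1 T1 s2 T2 s3 :
  bexec c1 s1 T1 s2 -> bexec c2 s2 T2 s3 -> bexec (Seq c1 c2) s1 (T1 + T2) s3.
Proof.
move=> [t1 le1 H1] [t2 le2 H2]; exists (t1 + t2); first exact: leq_add.
exact: exec_Seq H1 H2.
Qed.

Lemma bexec_Branch r c0 c1 c2 s T s' :
  bexec (branch (s r) c0 c1 c2) s T s' -> bexec (Branch r c0 c1 c2) s T.+2 s'.
Proof. by move=> [t le_t H]; exists t.+2 => //; apply: exec_Branch. Qed.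

Lemma bexec_Push r b s : bexec (Push r b) s 2 (upd s r (b :: s r)).
Proof. by exists 2 => //; apply: exec_Push. Qed.

Lemma bexec_Pop r s : bexec (Pop r) s 1 (upd s r (behead (s r))).
Proof. by exists 1 => //; apply: exec_Pop. Qed.

Lemma bexec_Skip s : bexec Skip s 0 s.
Proof. by exists 0 => //; apply: exec_Skip. Qed.

Lemma bexec_While_nil r c s : s r = [::] -> bexec (While r c) s 1 s.
Proof. by move=> ?; exists 1 => //; apply: exec_While_nil. Qed.

Lemma bexec_While_cons r c s1 T1 s2 T2 s3 : s1 r <> [::] ->
  bexec c s1 T1 s2 -> bexec (While r c) s2 T2 s3 ->
  bexec (While r c) s1 (T1 + T2).+2 s3.
Proof.
move=> s1r [t1 le1 H1] [t2 le2 H2]; exists (t1.+2 + t2); first lia.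
exact: exec_While_cons H1 H2.
Qed.

Lemma upd_id s r : upd s r (s r) = s.
Proof. by apply/funext => i; rewrite /upd; case: eqP => [->|]. Qed.


(** A pass removes one bit of the controlling register, so [I j] is the store after [j] passes. Each
    pass costs two more steps, for the test and the jump back, and the exit costs one. *)
Lemma bexec_loop r c T w (I : nat -> store) :
  (forall j, I j r = drop j w) ->
  (forall j, j < size w -> bexec c (I j) T (I j.+1)) ->
  bexec (While r c) (I 0) (size w * T.+2 + 1) (I (size w)).
Proof.
move=> Ir Ic.
suff H n j : n + j = size w -> bexec (While r c) (I j) (n * T.+2 + 1) (I (size w)).
  by apply: H; rewrite addn0.
elim: n j => [|n IH] j Ej.
  by rewrite -Ej; apply: bexec_While_nil; rewrite Ir drop_oversize // -Ej.
have lt_j : j < size w by lia.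
apply: bexec_le (bexec_While_cons _ (Ic j lt_j) (IH j.+1 _)); try lia.
by move=> E; have := size_drop j w; rewrite -Ir E /=; lia.
Qed.

(** * Erasing, moving and copying registers *)

Definition clear r := While r (Pop r).

Lemma clearP r s : bexec (clear r) s (3 * size (s r) + 1) (upd s r [::]).
Proof.
have := @bexec_loop r (Pop r) 1 (s r) (fun j => upd s r (drop j (s r))).
rewrite drop0 upd_id drop_size mulnC; apply=> j; first by rewrite /upd eqxx.
move=> lt_j; have := bexec_Pop r (upd s r (drop j (s r))).
congr bexec; apply/funext => i; rewrite /upd; case: eqP => // _.
by rewrite eqxx -drop1 drop_drop add1n.
Qed.

Definition move_rev r d :=
  While r (Seq (Branch r Skip (Push d false) (Push d true)) (Pop r)).

Lemma move_revP r d s : r <> d ->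
  bexec (move_rev r d) s (7 * size (s r) + 1) (upd (upd s d (rev (s r) ++ s d)) r [::]).
Proof.
move=> /eqP ne_rd; set w := s r.
have := @bexec_loop r (Seq (Branch r Skip (Push d false) (Push d true)) (Pop r)) 5 w
  (fun j => upd (upd s d (rev (take j w) ++ s d)) r (drop j w)).
rewrite drop0 take0 cat0s !upd_id drop_size take_size mulnC; apply=> j.
  by rewrite /upd eqxx.
move=> lt_j; set s1 := upd _ _ _; set s2 := upd _ _ _.
pose b := nth true w j.
have E : s1 r = b :: drop j.+1 w by rewrite /s1 /upd eqxx (drop_nth true).
apply: bexec_le (bexec_Seq (s2 := upd s1 d (b :: s1 d)) (T1 := 4) (T2 := 1) _ _) => //.
  apply: (@bexec_Branch _ _ _ _ _ 2); rewrite E; clearbody b; case: (b) => /=;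
  exact: bexec_Push.
have := bexec_Pop r (upd s1 d (b :: s1 d)); congr bexec.
apply/funext => i; rewrite /s2 /s1 /upd; case: (altP (i =P r)) => [_|_].
  by rewrite (negPf ne_rd) eqxx (drop_nth true lt_j).
by case: eqP => // _; rewrite eqxx [d == r]eq_sym (negPf ne_rd) (take_nth true lt_j) rev_rcons.
Qed.

(** A transfer reverses a word: the first one empties [r] into [tmp], the second one empties [tmp]
    into both [r] and [d], which restores the order. *)
Definition copy r d tmp := Seq (move_rev r tmp)
  (While tmp (Seq (Branch tmp Skip (Seq (Push r false) (Push d false))
                                   (Seq (Push r true) (Push d true))) (Pop tmp))).

Lemma copyP r d tmp s : r != d -> r != tmp -> d != tmp ->
  s d = [::] -> s tmp = [::] ->
  bexec (copy r d tmp) s (20 * size (s r) + 20) (upd s d (s r)).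
Proof.
move=> ne_rd ne_rt ne_dt sd st; set w := s r.
have H1 := @move_revP r tmp s (elimN eqP ne_rt); rewrite -/w in H1.
apply: bexec_le (bexec_Seq H1 (T2 := size w * 9 + 1) _); first lia.
set c := (X in While _ X); set s1 := upd _ _ _.
have := @bexec_loop tmp c 7 (rev w)
  (fun j => upd (upd (upd s d (rev (take j (rev w)))) r (rev (take j (rev w))))
    tmp (drop j (rev w))).
rewrite drop0 drop_size take_size take0 revK size_rev.
have -> : upd (upd (upd s d [::]) r [::]) tmp (rev w) = s1.
  rewrite /s1; apply/funext => i; rewrite /upd; case: eqP => [->|].
    by rewrite eq_sym (negPf ne_rt) st cats0.
  by case: eqP => // _; case: eqP => // ->.
have -> : upd (upd (upd s d w) r w) tmp [::] = upd s d w.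
  apply/funext => i; rewrite /upd; case: eqP => [->|].
    by rewrite eq_sym (negPf ne_dt).
  by case: eqP => // ->; rewrite (negPf ne_rd).
apply=> j; first by rewrite /upd eqxx.
move=> lt_jw; have lt_j : j < size (rev w) by rewrite size_rev.
 set s2 := upd _ _ _; set s3 := upd _ _ _.
pose b := nth true (rev w) j.
have E : s2 tmp = b :: drop j.+1 (rev w) by rewrite /s2 /upd eqxx (drop_nth true).
pose s2' := upd s2 r (b :: s2 r).
apply: bexec_le (bexec_Seq (s2 := upd s2' d (b :: s2' d)) (T1 := 6) (T2 := 1) _ _) => //.
  apply: (@bexec_Branch _ _ _ _ _ 4); rewrite E; clearbody b.
  by case: (b) @s2' => s2' /=; [exact: (bexec_Seq (bexec_Push r true s2) (bexec_Push d true s2'))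
    |exact: (bexec_Seq (bexec_Push r false s2) (bexec_Push d false s2'))].
have := bexec_Pop tmp (upd s2' d (b :: s2' d)); congr bexec.
have Et : rev (take j.+1 (rev w)) = b :: rev (take j (rev w)).
  by rewrite (take_nth true lt_j) rev_rcons.
apply/funext => i; rewrite /s3 Et /s2' /s2 /upd; case: (altP (i =P tmp)) => [_|_].
  rewrite [tmp == d]eq_sym [tmp == r]eq_sym (negPf ne_dt) (negPf ne_rt) eqxx.
  by rewrite (drop_nth true lt_j).
case: (altP (i =P d)) => [->|_].
  by rewrite [d == r]eq_sym (negPf ne_rd) eqxx (negPf ne_dt).
by case: eqP => // _; rewrite eqxx (negPf ne_rt).
Qed.

Definition relocate r d tmp := Seq (move_rev r tmp) (move_rev tmp d).

Lemma relocateP r d tmp s : r != d -> r != tmp -> d != tmp ->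
  s d = [::] -> s tmp = [::] ->
  bexec (relocate r d tmp) s (20 * size (s r) + 20) (upd (upd s d (s r)) r [::]).
Proof.
move=> ne_rd ne_rt ne_dt sd st.
have H1 := @move_revP r tmp s (elimN eqP ne_rt).
have ne_td : tmp <> d by apply/eqP; rewrite eq_sym.
set s1 := upd _ r _ in H1.
have E1 : s1 tmp = rev (s r).
  by rewrite /s1 /upd [tmp == r]eq_sym (negPf ne_rt) eqxx st cats0.
have E2 : s1 d = [::].
  by rewrite /s1 /upd [d == r]eq_sym (negPf ne_rd) (negPf ne_dt).
have := bexec_Seq H1 (move_revP s1 ne_td).
rewrite E1 E2 revK cats0 size_rev.
have -> : upd (upd s1 d (s r)) tmp [::] = upd (upd s d (s r)) r [::].
  apply/funext => i; rewrite /s1 /upd; case: (altP (i =P tmp)) => [->|_].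
    by rewrite [_ == r]eq_sym [_ == d]eq_sym (negPf ne_rt) (negPf ne_dt) st.
  by case: (altP (i =P d)) => // ->; rewrite eq_sym (negPf ne_rd).
by apply: bexec_le; lia.
Qed.

(** * Stack frames of registers *)

Definition wt (ws : seq bitseq) : nat := size (flatten ws).

Lemma wt_cat ws ws' : wt (ws ++ ws') = wt ws + wt ws'.
Proof. by rewrite /wt flatten_cat size_cat. Qed.

Lemma wt_cons w ws : wt (w :: ws) = size w + wt ws.
Proof. by rewrite /wt /= size_cat. Qed.

Lemma leq_size_nth ws i : size (nth [::] ws i) <= wt ws.
Proof.
elim: ws i => [|w ws IH] [|i] //=; rewrite wt_cons ?leq_addr //.
exact: leq_trans (IH i) (leq_addl _ _).
Qed.

(** The stack discipline: the registers below [b] belong to the callers and are left intact, the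
    words computed stand from [b] on, and all further registers are empty. *)
Definition place (s : store) b ws : store :=
  fun i => if i < b then s i else nth [::] ws (i - b).

Definition fresh (s : store) b := forall i, b <= i -> s i = [::].

Lemma place_fresh s b ws : fresh (place s b ws) (b + size ws).
Proof.
move=> i le_i; rewrite /place ltnNge (leq_trans (leq_addr _ _) le_i) /=.
by rewrite nth_default //; lia.
Qed.

Lemma place_ext s b ws ws' :
  (forall j, nth [::] ws j = nth [::] ws' j) -> place s b ws = place s b ws'.
Proof. by move=> E; apply/funext => i; rewrite /place E. Qed.

Lemma place_cat s b ws ws' :
  place (place s b ws) (b + size ws) ws' = place s b (ws ++ ws').
Proof.
apply/funext => i; rewrite /place nth_cat; case: (ltnP i b) => [lt_i|le_b].
  by rewrite (leq_trans lt_i (leq_addr _ _)).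
by rewrite -ltn_subLR ?subnDA.
Qed.

Lemma place_cons s b w ws : place (place s b [:: w]) b.+1 ws = place s b (w :: ws).
Proof. by rewrite -addn1 (place_cat s b [:: w]). Qed.

Lemma place_nil s b : fresh s b -> place s b [::] = s.
Proof.
by move=> Hs; apply/funext => i; rewrite /place nth_nil; case: ltnP => // /Hs.
Qed.

Lemma place_at s b ws j : place s b ws (b + j) = nth [::] ws j.
Proof. by rewrite /place ltnNge leq_addr /= addKn. Qed.

Lemma place_upd s b ws j w :
  upd (place s b ws) (b + j) w = place s b (set_nth [::] ws j w).
Proof.
apply/funext => i; rewrite /upd /place nth_set_nth /=.
case: (ltnP i b) => [lt_i|le_b]; first by rewrite ifN // ltn_eqF // ltn_addr.
by rewrite -(eqn_add2l b (i - b)) subnKC.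
Qed.

Lemma place_upd0 s b ws w : upd (place s b ws) b w = place s b (set_nth [::] ws 0 w).
Proof. by rewrite -place_upd addn0. Qed.

Lemma map_place s b ws loc : all (gtn b) loc -> map (place s b ws) loc = map s loc.
Proof.
move=> /allP H; apply/eq_in_map => i /H /= lt_i; by rewrite /place lt_i.
Qed.

Lemma map_place_iota s b ws ws' ws2 n m : n = b + size ws -> m = size ws' ->
  map (place s b (ws ++ ws' ++ ws2)) (iota n m) = ws'.
Proof.
move=> -> ->; apply: (@eq_from_nth _ [::]); rewrite size_map size_iota // => i lt_i.
rewrite (nth_map 0) ?size_iota // nth_iota // -addnA place_at.
by rewrite nth_cat ltnNge leq_addr /= addKn nth_cat lt_i.
Qed.

Lemma all_gtnW b b' loc : b <= b' -> all (gtn b) loc -> all (gtn b') loc.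
Proof. by move=> le_b; apply: sub_all => i /= /leq_trans; apply. Qed.

Lemma all_gtn_iota b n m : n + m <= b -> all (gtn b) (iota n m).
Proof. by move=> le_b; apply/allP => i; rewrite mem_iota /= => /andP[_]; lia. Qed.

Fixpoint clear_all b n := if n is n'.+1 then Seq (clear b) (clear_all b.+1 n') else Skip.

Lemma clear_allP s b ws ws' :
  bexec (clear_all b (size ws)) (place s b (ws ++ ws')) (3 * wt ws + size ws)
    (place s b (nseq (size ws) [::] ++ ws')).
Proof.
elim: ws s b => [|w ws IH] s b; first exact: bexec_Skip.
have := clearP b (place s b ((w :: ws) ++ ws')).
rewrite place_upd0 /= => H1; have {}IH := IH (place s b [:: [::]]) b.+1.
rewrite !place_cons in IH; have := bexec_Seq H1 IH.
by apply: bexec_le; rewrite -[X in place _ _ _ X]addn0 place_at wt_cons /=; lia.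
Qed.

Fixpoint shift_all b g n tmp :=
  if n is n'.+1 then Seq (relocate (b + g) b tmp) (shift_all b.+1 g n' tmp) else Skip.

Lemma nth_shift g (w : bitseq) ws j : 0 < g ->
  nth [::] (set_nth [::] (set_nth [::] (nseq g [::] ++ w :: ws) 0 w) g [::]) j =
  nth [::] (w :: nseq g [::] ++ ws) j.
Proof.
move=> g_gt0; rewrite !nth_set_nth /= nth_set_nth /=.
case: j => [|j] /=; first by rewrite ltn_eqF.
rewrite !nth_cat size_nseq !nth_nseq; case: (ltngtP j.+1 g) => Hj.
- by rewrite ?if_same.
- by rewrite subSn.
- by rewrite ?if_same.
Qed.

Lemma shift_allP s b g ws tmp : 0 < g -> b + g + size ws <= tmp ->
  bexec (shift_all b g (size ws) tmp) (place s b (nseq g [::] ++ ws))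
    (20 * (wt ws + size ws)) (place s b ws).
Proof.
move=> g_gt0; elim: ws s b => [|w ws IH] s b le_t.
  rewrite (@place_ext s b (nseq g [::] ++ [::]) [::]).
    exact: bexec_Skip.
  by move=> j; rewrite cats0 nth_nseq nth_nil if_same.
rewrite [in shift_all _ _ _ _]/=; rewrite /= in le_t.
set s0 := place s b _.
have sg : s0 (b + g) = w.
  by rewrite /s0 place_at nth_cat size_nseq ltnn subnn.
have sb : s0 b = [::].
  by rewrite /s0 -[X in place _ _ _ X]addn0 place_at nth_cat size_nseq g_gt0 nth_nseq g_gt0.
have st : s0 tmp = [::].
  by apply: place_fresh; rewrite size_cat size_nseq /=; lia.
have ne1 : b + g != b by lia.
have ne2 : b + g != tmp by lia.
have ne3 : b != tmp by lia.
have := relocateP ne1 ne2 ne3 sb st.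
rewrite sg /s0 place_upd0 place_upd.
rewrite (@place_ext s b (set_nth _ _ _ _) (w :: nseq g [::] ++ ws)); last first.
  by move=> j; apply: nth_shift.
have le_t' : b.+1 + g + size ws <= tmp by lia.
move=> H1; have {}IH := IH (place s b [:: w]) b.+1 le_t'; rewrite !place_cons in IH.
by have := bexec_Seq H1 IH; apply: bexec_le; rewrite ?wt_cons /=; lia.
Qed.

(** Drops [n1] intermediate words and slides the [n2] words of the result down over them, in
    increasing order so that every destination is already empty. *)
Definition discard b n1 n2 :=
  Seq (clear_all b n1) (if n1 is 0 then Skip else shift_all b n1 n2 (b + n1 + n2)).

Lemma discardP s b ws ws' n n' : size ws = n -> size ws' = n' ->
  bexec (discard b n n') (place s b (ws ++ ws'))
    (3 * wt ws + n + 20 * (wt ws' + n')) (place s b ws').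
Proof.
move=> <- <-; apply: bexec_Seq (clear_allP _ _ _ _) _.
case: (posnP (size ws)) => [/size0nil -> /=|gt0].
  by apply: bexec_le (bexec_Skip _).
have := @shift_allP s b (size ws) ws' (b + size ws + size ws') gt0 (leqnn _).
by case: (size ws) gt0.
Qed.

(** * Poly-time functions between encoded types *)

Structure enctype := EncType {
  car :> Type;
  ar : nat;
  enc : car -> seq bitseq;
  size_enc : forall x, size (enc x) = ar
}.

(* [h] is poly-time: reading the argument off any registers [loc] below [b], the program writes
   the words [h x] on the registers from [b] on. *)
Definition PTr (A : enctype) (h : A -> seq bitseq) : Prop :=
  (exists d, forall x, size (h x) = d) /\
  exists k, (forall x, wt (h x) <= pb k (wt (enc x))) /\
    forall loc b, all (gtn b) loc -> exists c, forall s x,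
      map s loc = enc x -> fresh s b ->
      bexec c s (pb k (wt (enc x))) (place s b (h x)).

Definition PT (A B : enctype) (f : A -> B) : Prop := PTr (fun x => enc (f x)).

Lemma PTr_intro (A : enctype) (h : A -> seq bitseq) d T : 
  (forall x, size (h x) = d) -> polyb T ->
  (forall x, wt (h x) <= T (wt (enc x))) ->
  (forall loc b, all (gtn b) loc -> exists c, forall s x,
      map s loc = enc x -> fresh s b ->
      bexec c s (T (wt (enc x))) (place s b (h x))) ->
  PTr h.
Proof.
move=> Hd [k Hk] Hw Hc; split; first by exists d.
exists k; split=> [x|loc b Hb]; first exact: leq_trans (Hw x) (Hk _).
have [c {}Hc] := Hc loc b Hb; exists c => s x Hs Hf.
exact: bexec_le (Hk _) (Hc s x Hs Hf).
Qed.

Lemma PTr_ext (A : enctype) (h h' : A -> seq bitseq) : h =1 h' -> PTr h -> PTr h'.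
Proof. by move=> /funext ->. Qed.

Lemma PT_ext (A B : enctype) (f f' : A -> B) : f =1 f' -> PT f -> PT f'.
Proof. by move=> /funext ->. Qed.

Lemma PTr_cat (A : enctype) (h h' : A -> seq bitseq) :
  PTr h -> PTr h' -> PTr (fun x => h x ++ h' x).
Proof.
move=> [[d Hd] [k [Hw Hc]]] [[d' Hd'] [k' [Hw' Hc']]].
apply: (@PTr_intro _ _ (d + d') (fun w => pb k w + pb k' w)); auto with polyb.
- by move=> x; rewrite size_cat Hd Hd'.
- by move=> x; rewrite wt_cat leq_add.
- move=> loc b Hb; have [c {}Hc] := Hc loc b Hb.
  have [c' {}Hc'] := Hc' loc (b + d) (all_gtnW (leq_addr _ _) Hb).
  exists (Seq c c') => s x Hs Hf; apply: bexec_Seq (Hc s x Hs Hf) _.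
  rewrite -place_cat Hd; apply: Hc'; first by rewrite map_place.
  by rewrite -(Hd x); apply: place_fresh.
Qed.

Lemma PTr_nil (A : enctype) : PTr (fun x : A => [::]).
Proof.
apply: (@PTr_intro _ _ 0 (fun=> 0)) => //; auto with polyb.
by move=> loc b _; exists Skip => s x _ Hf; rewrite place_nil //; apply: bexec_Skip.
Qed.

Lemma place_empty s b : fresh s b -> s = place s b [:: [::]].
Proof.
by move=> Hf; rewrite -[LHS](place_nil Hf); apply: place_ext => -[|j]; rewrite //= nth_nil.
Qed.

Lemma place1 s b w : fresh s b -> upd s b w = place s b [:: w].
Proof. by move=> Hf; rewrite [in LHS](place_empty Hf) place_upd0. Qed.

Lemma PTr_reg (A : enctype) i : PTr (fun x : A => [:: nth [::] (enc x) i]).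
Proof.
apply: (@PTr_intro _ _ 1 (fun w => 20 * w + 20)) => //; auto with polyb.
  by move=> x; rewrite wt_cons addn0; have := leq_size_nth (enc x) i; lia.
move=> loc b Hb; case: (ltnP i (size loc)) => [lt_i|le_i].
  have lt_b : nth 0 loc i < b by have /allP/(_ _ (mem_nth 0 lt_i)) := Hb.
  exists (copy (nth 0 loc i) b b.+1) => s x Hs Hf.
  have E : nth [::] (enc x) i = s (nth 0 loc i) by rewrite -Hs (nth_map 0).
  rewrite E -place1 //.
  apply: (bexec_le _ (copyP _ _ _ _ _)); try apply: Hf; try lia.
  by have := leq_size_nth (enc x) i; rewrite E; lia.
exists Skip => s x Hs Hf; rewrite nth_default -?Hs ?size_map //.
by rewrite -place_empty //; apply: bexec_le (bexec_Skip _).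
Qed.

Fixpoint push_word r w := if w is b :: w' then Seq (push_word r w') (Push r b) else Skip.

Lemma push_wordP r w s : s r = [::] -> bexec (push_word r w) s (2 * size w) (upd s r w).
Proof.
move=> sr; elim: w => [|b w IH] /=.
  by rewrite -sr upd_id; apply: bexec_Skip.
have := bexec_Seq IH (bexec_Push r b _).
have -> : upd (upd s r w) r (b :: upd s r w r) = upd s r (b :: w).
  by apply/funext => i; rewrite /upd eqxx; case: eqP.
by apply: bexec_le; lia.
Qed.

Lemma PTr_const (A : enctype) ws : PTr (fun x : A => ws).
Proof.
elim: ws => [|w ws IH]; first exact: PTr_nil.
apply: (@PTr_cat _ (fun=> [:: w]) (fun=> ws)) => //.
apply: (@PTr_intro _ _ 1 (fun=> 2 * size w)) => //; auto with polyb.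
  by move=> x; rewrite wt_cons addn0; lia.
move=> loc b Hb; exists (push_word b w) => s x Hs Hf.
by rewrite -place1 //; apply: push_wordP; apply: Hf.
Qed.

(** The intermediate value is computed at [b], the result above it, and [discard] drops the former.
    The second program is charged on the length of [enc (f x)], itself polynomial, whence the nested
    bound. *)
Lemma PTr_comp (A B : enctype) (f : A -> B) (h : B -> seq bitseq) :
  PT f -> PTr h -> PTr (fun x => h (f x)).
Proof.
move=> [_ [k [Hw Hc]]] [[d Hd] [k' [Hw' Hc']]].
pose T w := pb k w + pb k' (pb k w) +
  (3 * pb k w + ar B + 20 * (pb k' (pb k w) + d)).
have le_T x : wt (h (f x)) <= pb k' (pb k (wt (enc x))).
  by apply: leq_trans (Hw' _) _; apply: pb_monor.
apply: (@PTr_intro _ _ d T).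
- by move=> x; apply: Hd.
- by rewrite /T; auto 10 with polyb.
- by move=> x; have := le_T x; rewrite /T; lia.
- move=> loc b Hb; have [c {}Hc] := Hc loc b Hb.
  have [|c' {}Hc'] := Hc' (iota b (ar B)) (b + ar B).
    exact: all_gtn_iota.
  exists (Seq (Seq c c') (discard b (ar B) d)) => s x Hs Hf.
  have H1 := Hc s x Hs Hf; set s1 := place _ _ _ in H1.
  have H2 : bexec c' s1 (pb k' (pb k (wt (enc x)))) (place s1 (b + ar B) (h (f x))).
    apply: bexec_le (Hc' s1 (f x) _ _); first exact: pb_monor.
      rewrite /s1 -[enc (f x)]cats0 -[X in place _ _ X]cat0s.
      by rewrite map_place_iota ?cats0 ?addn0 ?size_enc.
    by rewrite -(size_enc (f x)); apply: place_fresh.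
  rewrite /s1 -{1}(size_enc (f x)) place_cat in H2.
  apply: bexec_le (bexec_Seq (bexec_Seq H1 H2) (discardP s b (size_enc (f x)) (Hd (f x)))).
  by have := le_T x; have := Hw x; rewrite /T; lia.
Qed.

Lemma PT_branch (A B : enctype) i (f0 f1 f2 f : A -> B) :
  PT f0 -> PT f1 -> PT f2 ->
  (forall x, f x = branch (nth [::] (enc x) i) (f0 x) (f1 x) (f2 x)) -> PT f.
Proof.
move=> [_ [k0 [Hw0 Hc0]]] [_ [k1 [Hw1 Hc1]]] [_ [k2 [Hw2 Hc2]]] Hf.
apply: (@PTr_intro _ _ (ar B) (fun w => (pb k0 w + (pb k1 w + pb k2 w)).+2)).
- by move=> x; apply: size_enc.
- by auto 10 with polyb.
- move=> x; rewrite Hf; have := Hw0 x; have := Hw1 x; have := Hw2 x.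
  by case: (nth _ _ _) => [|[] w] /=; lia.
move=> loc b Hb; have [c0 {}Hc0] := Hc0 _ _ Hb; have [c1 {}Hc1] := Hc1 _ _ Hb.
have [c2 {}Hc2] := Hc2 _ _ Hb.
case: (ltnP i (size loc)) => [lt_i|le_i].
  exists (Branch (nth 0 loc i) c0 c1 c2) => s x Hs Hx; apply: bexec_Branch.
  rewrite Hf -Hs (nth_map 0) // Hs.
  have := Hc0 s x Hs Hx; have := Hc1 s x Hs Hx; have := Hc2 s x Hs Hx.
  by case: (s _) => [|[] w] /= H2 H1 H0;
    [apply: bexec_le H0|apply: bexec_le H2|apply: bexec_le H1]; lia.
(* No register carries a word of index [i]: the tested word is the default empty one, and [f0] is
   the only case. *)
exists c0 => s x Hs Hx; rewrite Hf nth_default -?Hs ?size_map // Hs /=.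
by apply: bexec_le (Hc0 s x Hs Hx); lia.
Qed.

(** * Encodings of types and closure properties *)

Canonical bool_enc := @EncType bool 1 (fun b => [:: [:: b]]) (fun=> erefl).
Canonical word_enc := @EncType (seq bool) 1 (fun w => [:: w]) (fun=> erefl).
(** Unary, so that sizes bound values and a number can drive a loop. *)
Canonical nat_enc := @EncType nat 1 (fun n => [:: nseq n true]) (fun=> erefl).

Lemma size_enc_prod (A B : enctype) (x : A * B) :
  size (enc x.1 ++ enc x.2) = ar A + ar B.
Proof. by rewrite size_cat !size_enc. Qed.
Canonical prod_enc (A B : enctype) := @EncType (A * B) _ _ (@size_enc_prod A B).

(** The first word is the tag tested by a case analysis; [None] is padded with empty words since the
    number of words of an encoding is fixed. *)
Definition enc_option (B : enctype) (o : option B) : seq bitseq :=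
  if o is Some y then [:: true] :: enc y else nseq (ar B).+1 [::].
Lemma size_enc_option (B : enctype) (o : option B) : size (enc_option o) = (ar B).+1.
Proof. by case: o => [y|]; rewrite /= ?size_nseq ?size_enc. Qed.
Canonical option_enc (B : enctype) := @EncType (option B) _ _ (@size_enc_option B).

(** The bound on all the intermediate accumulators keeps the loop polynomial: iterating a function
    that doubles the length is already exponential. Each pass computes the new accumulator above the
    old one, then discards the latter together with the current bit. *)
Lemma PT_foldl (A S : enctype) (w : A -> bitseq) (i : A -> S) (f : A * S * bool -> S) k :
  PT w -> PT i -> PT f ->
  (forall x j, wt (enc (foldl (fun a b => f (x, a, b)) (i x) (take j (w x)))) <=
     pb k (wt (enc x))) ->
  PT (fun x => foldl (fun a b => f (x, a, b)) (i x) (w x)).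
Proof.
move=> Pw Pi [_ [kf [_ Hcf]]] Hk.
have [[d Hd] [k' [Hw' Hc']]] := PTr_cat Pw Pi.
pose m := ar S; pose F x := foldl (fun a b => f (x, a, b)) (i x).
pose Tf u := pb kf (u + pb k u + 1).
pose Tbody u := 4 + (Tf u + (3 * (pb k u + 1) + m.+1 + 20 * (pb k u + m))) + 1.
pose T u := pb k' u + (pb k' u * (Tbody u).+2 + 1 + (1 + 20 * (pb k u + m))).
have le_w x : size (w x) <= pb k' (wt (enc x)).
  by apply: leq_trans (Hw' x); rewrite wt_cons leq_addr.
apply: (@PTr_intro _ _ m T).
- by move=> x; rewrite size_enc.
- by rewrite /T /Tbody /Tf; auto 20 with polyb.
- by move=> x; have := Hk x (size (w x)); rewrite take_size /T; lia.
move=> loc b Hb; have [c0 {}Hc0] := Hc' loc b Hb.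
have [|c1 {}Hc1] := Hcf (loc ++ iota b.+1 m ++ [:: b.+1 + m]) (b.+1 + m).+1.
  rewrite !all_cat all_gtn_iota /= ?(all_gtnW _ Hb) //; lia.
(* Registers from [b] on: the rest of the word, the accumulator, the current bit. *)
pose body := Seq (Seq (Branch b Skip (Push (b.+1 + m) false) (Push (b.+1 + m) true)) (Pop b))
  (Seq c1 (discard b.+1 m.+1 m)).
exists (Seq c0 (Seq (While b body) (discard b 1 m))) => s x Hs Hf.
pose I j := place s b (drop j (w x) :: enc (F x (take j (w x)))).
have H0 : bexec c0 s (pb k' (wt (enc x))) (I 0).
  by rewrite /I drop0 take0; apply: Hc0.
have Hbody j : j < size (w x) -> bexec body (I j) (Tbody (wt (enc x))) (I j.+1).
  move=> lt_j; pose a := nth true (w x) j; pose v := drop j.+1 (w x).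
  pose S0 := F x (take j (w x)); pose S1 := F x (take j.+1 (w x)).
  have ES1 : S1 = f (x, S0, a) by rewrite /S1 (take_nth true lt_j) /F foldl_rcons.
  have EI : I j = place s b ((a :: v) :: enc S0) by rewrite /I (drop_nth true lt_j).
  pose s1 := place s b (((a :: v) :: enc S0) ++ [:: [:: a]]).
  pose s2 := place s b ((v :: enc S0) ++ [:: [:: a]]).
  have Ebm : b.+1 + m = b + size ((a :: v) :: enc S0) by rewrite /= size_enc; lia.
  have H1 : bexec (Branch b Skip (Push (b.+1 + m) false) (Push (b.+1 + m) true)) (I j) 4 s1.
    have E0 : I j (b.+1 + m) = [::] by rewrite EI Ebm place_at nth_default.
    apply: (@bexec_Branch _ _ _ _ _ 2); rewrite {1}EI -[X in place _ _ _ X]addn0 place_at /=.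
    have -> : s1 = upd (I j) (b.+1 + m) [:: a].
      by rewrite /s1 -place_cat -Ebm place1 EI // Ebm; apply: place_fresh.
    by have := bexec_Push (b.+1 + m) a (I j); rewrite E0; case: (a).
  have H2 : bexec (Pop b) s1 1 s2.
    have := bexec_Pop b s1; congr bexec.
    by rewrite {2}/s1 -[X in place _ _ _ X]addn0 place_at place_upd0.
  have H3 : bexec c1 s2 (Tf (wt (enc x))) (place s b (v :: (enc S0 ++ [:: [:: a]]) ++ enc S1)).
    have -> : place s b (v :: (enc S0 ++ [:: [:: a]]) ++ enc S1) =
        place s2 (b.+1 + m).+1 (enc S1).
      rewrite /s2 -cat_cons -place_cat; congr place.
      by rewrite Ebm /= size_cat /=; lia.
    rewrite ES1; apply: bexec_le (Hc1 s2 (x, S0, a) _ _).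
    + apply: pb_monor; rewrite /= !wt_cat [wt [:: [:: a]]]/= !leq_add //; exact: Hk.
    + rewrite !map_cat /= map_place ?Hs // -catA; congr (_ ++ (_ ++ [:: _])).
        rewrite /s2 -[v :: enc S0]/([:: v] ++ enc S0) -catA.
        by rewrite map_place_iota ?addn1 ?size_enc.
      by rewrite Ebm -[size _]/(size (v :: enc S0)) /s2 place_at nth_cat ltnn subnn.
    + have -> : (b.+1 + m).+1 = b + size ((v :: enc S0) ++ [:: [:: a]]).
        by rewrite Ebm /= size_cat /=; lia.
      exact: place_fresh.
  rewrite -place_cons in H3.
  have H4 := @discardP (place s b [:: v]) b.+1 (enc S0 ++ [:: [:: a]]) (enc S1) m.+1 m.
  have sz4 : size (enc S0 ++ [:: [:: a]]) = m.+1 by rewrite size_cat size_enc addn1.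
  have {}H4 := H4 sz4 (size_enc _).
  have -> : I j.+1 = place (place s b [:: v]) b.+1 (enc S1) by rewrite place_cons.
  apply: bexec_le (bexec_Seq (bexec_Seq H1 H2) (bexec_Seq H3 H4)).
  have hS0 : wt (enc S0) <= pb k (wt (enc x)) := Hk x j.
  have hS1 : wt (enc S1) <= pb k (wt (enc x)) := Hk x j.+1.
  by rewrite /Tbody wt_cat -[wt [:: [:: a]]]/1; lia.
have Ib j : I j b = drop j (w x) by rewrite /I -[X in place _ _ _ X]addn0 place_at.
have H1 := bexec_loop Ib Hbody.
have H2 := @discardP s b [:: [::]] (enc (F x (w x))) 1 m erefl (size_enc _).
have E : I (size (w x)) = place s b ([:: [::]] ++ enc (F x (w x))).
  by rewrite /I drop_size take_size.
rewrite -E in H2.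
apply: bexec_le (bexec_Seq H0 (bexec_Seq H1 H2)).
rewrite /T; set u := wt (enc x).
have hS : wt (enc (F x (w x))) <= pb k u.
  by have := Hk x (size (w x)); rewrite take_size.
rewrite leq_add2l; apply: leq_add; last by rewrite -[wt [:: [::]]]/0; lia.
by rewrite leq_add2r leq_mul2r le_w orbT.
Qed.

Lemma PT_bound (A B : enctype) (f : A -> B) : PT f ->
  exists k, forall x, wt (enc (f x)) <= pb k (wt (enc x)).
Proof. by case=> _ [k [Hk _]]; exists k. Qed.

Lemma PT_foldlW (A S : enctype) (w : A -> bitseq) (i : A -> S)
    (f : A * S * bool -> S) T :
  PT w -> PT i -> PT f -> polyb T ->
  (forall x j, j <= size (w x) ->
     wt (enc (foldl (fun a b => f (x, a, b)) (i x) (take j (w x)))) <= T (wt (enc x))) ->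
  PT (fun x => foldl (fun a b => f (x, a, b)) (i x) (w x)).
Proof.
move=> Pw Pi Pf [k Hk] HT; apply: (PT_foldl Pw Pi Pf (k := k)) => x j.
case: (leqP j (size (w x))) => [le_j|lt_j]; first exact: leq_trans (HT x j le_j) (Hk _).
rewrite take_oversize ?(ltnW lt_j) // -[X in foldl _ _ X]take_size.
exact: leq_trans (HT x _ (leqnn _)) (Hk _).
Qed.

(** This covers all functions that only select, permute or duplicate encoded words, such as the
    projections and the conversions between types with the same encoding. *)
Lemma PT_wire (A B : enctype) (f : A -> B) idx :
  (forall x, enc (f x) = [seq nth [::] (enc x) i | i <- idx]) -> PT f.
Proof.
move=> Hf; rewrite /PT; apply: (PTr_ext (fun x => esym (Hf x))).
elim: idx {f Hf} => [|i idx IH]; first exact: PTr_nil.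
exact: (PTr_cat (PTr_reg A i) IH).
Qed.

Lemma PT_id (A : enctype) : PT (fun x : A => x).
Proof.
apply: (@PT_wire _ _ _ (iota 0 (ar A))) => x.
by rewrite map_nth_iota0 ?size_enc // -(size_enc x) take_size.
Qed.

Lemma PT_comp (A B C : enctype) (g : B -> C) (f : A -> B) :
  PT g -> PT f -> PT (fun x => g (f x)).
Proof. by move=> Hg Hf; apply: (PTr_comp Hf Hg). Qed.

Lemma PT_fst (A B C : enctype) (f : C -> A * B) : PT f -> PT (fun x => (f x).1).
Proof.
apply: PT_comp; apply: (@PT_wire _ _ _ (iota 0 (ar A))) => x.
by rewrite map_nth_iota0 ?size_enc ?leq_addr //= take_size_cat ?size_enc.
Qed.

Lemma PT_snd (A B C : enctype) (f : C -> A * B) : PT f -> PT (fun x => (f x).2).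
Proof.
apply: PT_comp; apply: (@PT_wire _ _ _ (iota (ar A) (ar B))) => x.
rewrite map_nth_iota ?size_enc ?addKn //= drop_size_cat ?size_enc //.
by rewrite -(size_enc x.2) take_size.
Qed.

Lemma PT_pair (A B C : enctype) (f : C -> A) (g : C -> B) :
  PT f -> PT g -> PT (fun x => (f x, g x)).
Proof. exact: PTr_cat. Qed.

Lemma PT_const (A B : enctype) (y : B) : PT (fun _ : A => y).
Proof. exact: PTr_const. Qed.

Lemma PT_comp2 (A B C D : enctype) (g : B -> C -> D) (f : A -> B) (h : A -> C) :
  PT (fun p => g p.1 p.2) -> PT f -> PT h -> PT (fun x => g (f x) (h x)).
Proof. by move=> Hg Hf Hh; apply: (PT_comp Hg (PT_pair Hf Hh)). Qed.

Lemma PT_Some (A B : enctype) (f : A -> B) : PT f -> PT (fun x => Some (f x)).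
Proof. by move=> Hf; apply: (PTr_cat (PTr_const A [:: [:: true]]) Hf). Qed.

Lemma PT_word_case (A B : enctype) (w : A -> seq bool) (f0 f1 f2 : A -> B) :
  PT w -> PT f0 -> PT f1 -> PT f2 ->
  PT (fun x => branch (w x) (f0 x) (f1 x) (f2 x)).
Proof.
move=> Hw H0 H1 H2.
have snd_ (f : A -> B) : PT f -> PT (fun p : seq bool * A => f p.2).
  by move=> Hf; apply: (PT_comp Hf); apply/PT_snd/PT_id.
have H : PT (fun p : seq bool * A => branch p.1 (f0 p.2) (f1 p.2) (f2 p.2)).
  exact: (PT_branch (i := 0) (snd_ _ H0) (snd_ _ H1) (snd_ _ H2)).
exact: (PT_comp H (PT_pair Hw (PT_id A))).
Qed.

Lemma PT_word_of_bool (A : enctype) (b : A -> bool) : PT b -> PT (fun x => [:: b x]).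
Proof.
move=> Hb; apply: (PT_comp (B := bool) (g := fun b => [:: b]) _ Hb).
exact: (@PT_wire _ _ _ [:: 0]).
Qed.

Lemma PT_if (A B : enctype) (b : A -> bool) (f g : A -> B) :
  PT b -> PT f -> PT g -> PT (fun x => if b x then f x else g x).
Proof.
move=> Hb Hf Hg; apply: PT_ext (PT_word_case (PT_word_of_bool Hb) Hg Hg Hf) => x /=.
by case: (b x).
Qed.

Lemma PT_edit (A : enctype) (c : nat -> cmd) (g : bitseq -> bitseq) (f : A -> seq bool) :
  (forall r s, bexec (c r) s 2 (upd s r (g (s r)))) -> (forall w, size (g w) <= (size w).+1) ->
  PT f -> PT (fun x => g (f x)).
Proof.
move=> Hc Hg; apply: PT_comp.
apply: (@PTr_intro _ _ 1 (fun w => 20 * w + 22)) => //; auto with polyb.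
  by move=> w; have := Hg w; rewrite !wt_cons /=; lia.
(* A word occupies exactly one register, so the claim is vacuous for the other lists of
   registers. *)
case=> [|r [|]] a Ha; try by exists Skip.
move: Ha => /=; rewrite andbT => lt_r.
exists (Seq (copy r a a.+1) (c a)) => s w [Hs] Hf.
have H := bexec_Seq (copyP (_ : r != a) (_ : r != a.+1) (_ : a != a.+1) (Hf _ _) (Hf _ _))
  (Hc a _).
have {}H := H (ltac:(lia)) (ltac:(lia)) (ltac:(lia)) (leqnn a) (leqnSn a).
rewrite Hs (place1 w Hf) in H.
rewrite -place1 //; move: H; rewrite wt_cons addn0.
rewrite -[X in place _ _ _ X]addn0 place_at.
have -> : upd (place s a [:: w]) a (g w) = upd s a (g w).
  by rewrite place_upd0 place1.
by apply: bexec_le; lia.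
Qed.

Lemma PT_consb (A : enctype) b (f : A -> seq bool) : PT f -> PT (fun x => b :: f x).
Proof. by apply: (@PT_edit _ (fun r => Push r b)) => // r s; apply: bexec_Push. Qed.

Lemma PT_behead (A : enctype) (f : A -> seq bool) : PT f -> PT (fun x => behead (f x)).
Proof.
apply: (@PT_edit _ Pop) => [r s|w]; first exact: bexec_le (bexec_Pop r s).
by rewrite size_behead; lia.
Qed.

Lemma PT_cons (A : enctype) (b : A -> bool) (f : A -> seq bool) :
  PT b -> PT f -> PT (fun x => b x :: f x).
Proof.
move=> Hb Hf; have := PT_if Hb (PT_consb true Hf) (PT_consb false Hf).
by apply: PT_ext => x; case: (b x).
Qed.

Lemma PT_ones (A : enctype) (n : A -> nat) : PT n -> PT (fun x => ones (n x)).
Proof. by apply: PT_comp; apply: (@PT_wire _ _ _ [:: 0]). Qed.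

Lemma PT_iter (A S : enctype) (n : A -> nat) (i : A -> S)
    (f : A * S -> S) T :
  PT n -> PT i -> PT f -> polyb T ->
  (forall x j, j <= n x ->
     wt (enc (iter j (fun a => f (x, a)) (i x))) <= T (wt (enc x))) ->
  PT (fun x => iter (n x) (fun a => f (x, a)) (i x)).
Proof.
move=> Hn Hi Hf HT Hw.
have E x j a : foldl (fun (a : S) (b : bool) => f (x, a)) a (nseq j true) =
    iter j (fun a => f (x, a)) a.
  by elim: j a => // j IH a; rewrite iterSr -IH.
have Hf' : PT (fun p : A * S * bool => f p.1).
  by apply: (PT_comp Hf); apply/PT_fst/PT_id.
apply: (@PT_ext _ _ (fun x => foldl (fun a b => f (x, a, b).1) (i x) (ones (n x)))).
  by move=> x; apply: E.
apply: (PT_foldlW (PT_ones Hn) Hi Hf' HT) => x j; rewrite size_nseq => le_j.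
by rewrite take_nseq // E; apply: Hw.
Qed.

Ltac pt := repeat first
  [ exact: PT_id
  | eassumption
  | exact: PT_const
  | apply: PT_pair
  | apply: PT_fst
  | apply: PT_snd
  | apply: PT_if
  | apply: PT_consb
  | apply: PT_cons
  | apply: PT_behead
  | apply: PT_ones
  | apply: PT_Some ].

(** * Operations on words and on unary numbers *)

Lemma wt_word (w : seq bool) : wt (enc w) = size w.
Proof. by rewrite wt_cons addn0. Qed.
Lemma wt_nat (n : nat) : wt (enc n) = n.
Proof. by rewrite wt_cons addn0 size_nseq. Qed.
Lemma wt_bool (b : bool) : wt (enc b) = 1.
Proof. by []. Qed.
Lemma wt_pair (A B : enctype) (x : A) (y : B) : wt (enc (x, y)) = wt (enc x) + wt (enc y).
Proof. exact: wt_cat. Qed.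
Definition wtE := (wt_pair, wt_word, wt_nat, wt_bool).

Lemma PT_size (A : enctype) (f : A -> seq bool) : PT f -> PT (fun x => size (f x)).
Proof.
apply: PT_comp.
have HS : PT (fun p : seq bool * nat * bool => p.1.2.+1).
  apply: (PT_comp (g := S)); last by pt.
  have H : PT (fun n => true :: ones n) by pt.
  exact: H.
have E (w : seq bool) n : foldl (fun (n : nat) (b : bool) => n.+1) n w = n + size w.
  by elim: w n => [|b w IH] n; rewrite /= ?addn0 // IH addnS.
apply: (@PT_ext _ _ (fun w : seq bool => foldl (fun (n : nat) (b : bool) => (w, n, b).1.2.+1) 0 w)).
  by move=> w; rewrite E.
apply: (PT_foldlW (T := id) _ _ HS); pt; auto with polyb.
by move=> w j le_j; rewrite E !wtE size_take_min add0n geq_minr.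
Qed.

Lemma PT_rev (A : enctype) (f : A -> seq bool) : PT f -> PT (fun x => rev (f x)).
Proof.
apply: PT_comp.
have HS : PT (fun p : seq bool * seq bool * bool => p.2 :: p.1.2) by pt.
have E (w v : seq bool) : foldl (fun v (b : bool) => b :: v) v w = rev w ++ v.
  by elim: w v => //= b w IH v; rewrite IH rev_cons cat_rcons.
apply: (@PT_ext _ _ (fun w : seq bool =>
  foldl (fun v (b : bool) => (w, v, b).2 :: (w, v, b).1.2) [::] w)).
  by move=> w; rewrite E cats0.
apply: (PT_foldlW (T := id) _ _ HS); pt; auto with polyb.
by move=> w j le_j; rewrite E cats0 !wtE size_rev size_take_min geq_minr.
Qed.

Lemma PT_cat (A : enctype) (f g : A -> seq bool) : PT f -> PT g -> PT (fun x => f x ++ g x).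
Proof.
apply: PT_comp2.
have HS : PT (fun p : (seq bool * seq bool) * seq bool * bool => p.2 :: p.1.2) by pt.
have E (w v : seq bool) : foldl (fun v (b : bool) => b :: v) v w = rev w ++ v.
  by elim: w v => //= b w IH v; rewrite IH rev_cons cat_rcons.
apply: (@PT_ext _ _ (fun p : seq bool * seq bool =>
  foldl (fun v (b : bool) => (p, v, b).2 :: (p, v, b).1.2) p.2 (rev p.1))).
  by move=> w; rewrite E revK.
apply: (PT_foldlW (T := id) _ _ HS); pt; auto with polyb.
  by apply: PT_rev; pt.
move=> [u v] j; rewrite size_rev E !wtE /= size_cat size_rev size_take_min size_rev.
by rewrite leq_add2r geq_minr.
Qed.

Lemma PT_drop (A : enctype) (n : A -> nat) (f : A -> seq bool) :
  PT n -> PT f -> PT (fun x => drop (n x) (f x)).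
Proof.
apply: PT_comp2.
have E j (w : seq bool) : iter j behead w = drop j w.
  by elim: j => [|j IH]; rewrite ?drop0 //= IH -drop1 drop_drop add1n.
apply: (@PT_ext _ _ (fun p : nat * seq bool => iter p.1 (fun a => behead (p, a).2) p.2)).
  by move=> p; apply: E.
apply: (PT_iter (f := fun q => behead q.2) (T := id)); pt; auto with polyb.
by move=> [n' w] j le_j; rewrite E !wtE /= size_drop /id; lia.
Qed.

Lemma PT_unary (A : enctype) (n : A -> nat) : PT (fun x => ones (n x)) -> PT n.
Proof. by []. Qed.

Lemma PT_subn (A : enctype) (m n : A -> nat) : PT m -> PT n -> PT (fun x => m x - n x).
Proof.
move=> Hm Hn; apply: PT_unary.
apply: (@PT_ext _ _ (fun x => drop (n x) (ones (m x)))); last by apply: PT_drop; pt.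
by move=> x; rewrite /ones drop_nseq.
Qed.

Lemma PT_addn (A : enctype) (m n : A -> nat) : PT m -> PT n -> PT (fun x => m x + n x).
Proof.
move=> Hm Hn; apply: PT_unary.
apply: (@PT_ext _ _ (fun x => ones (m x) ++ ones (n x))); last by apply: PT_cat; pt.
by move=> x; rewrite /ones nseqD.
Qed.

Lemma PT_succn (A : enctype) (n : A -> nat) : PT n -> PT (fun x => (n x).+1).
Proof. move=> Hn; apply: PT_unary; rewrite /ones /=; pt. Qed.

Lemma PT_take (A : enctype) (n : A -> nat) (f : A -> seq bool) :
  PT n -> PT f -> PT (fun x => take (n x) (f x)).
Proof.
move=> Hn Hf.
apply: (@PT_ext _ _ (fun x => rev (drop (size (f x) - n x) (rev (f x))))).
  by move=> x; have := take_rev (n x) (rev (f x)); rewrite revK size_rev => ->.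
by apply: PT_rev; apply: PT_drop; [apply: PT_subn; [exact: PT_size|]|exact: PT_rev].
Qed.

Lemma PT_muln (A : enctype) (m n : A -> nat) : PT m -> PT n -> PT (fun x => m x * n x).
Proof.
apply: PT_comp2.
have E j i : iter j (addn i) 0 = j * i by rewrite iter_addn_0 mulnC.
apply: (@PT_ext _ _ (fun p : nat * nat => iter p.1 (fun a => addn (p, a).1.2 (p, a).2) 0)).
  by move=> p; apply: E.
apply: (PT_iter (f := fun q => addn q.1.2 q.2) (T := fun w => w * w)); pt; auto with polyb.
  by apply: PT_addn; pt.
by move=> [m' n'] j le_j; rewrite E !wtE; rewrite /= in le_j *; nia.
Qed.

Lemma PT_leq (A : enctype) (m n : A -> nat) : PT m -> PT n -> PT (fun x => m x <= n x).
Proof.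
move=> Hm Hn; have H := PT_ones (PT_subn Hm Hn).
have := PT_word_case H (PT_const _ true) (PT_const _ false) (PT_const _ false).
by apply: PT_ext => x; rewrite /leq; case: (_ - _).
Qed.

Lemma PT_andb (A : enctype) (b c : A -> bool) : PT b -> PT c -> PT (fun x => b x && c x).
Proof. by move=> Hb Hc; apply: (PT_if Hb Hc); apply: PT_const. Qed.

Lemma PT_negb (A : enctype) (b : A -> bool) : PT b -> PT (fun x => ~~ b x).
Proof. by move=> Hb; apply: (PT_if Hb); apply: PT_const. Qed.

Lemma PT_eqn (A : enctype) (m n : A -> nat) : PT m -> PT n -> PT (fun x => m x == n x).
Proof.
move=> Hm Hn; have := PT_andb (PT_leq Hm Hn) (PT_leq Hn Hm).
by apply: PT_ext => x; rewrite eqn_leq.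
Qed.

Lemma PT_horner (A : enctype) (p : {poly nat}) (n : A -> nat) :
  PT n -> PT (fun x => p.[n x]%R).
Proof.
move=> Hn; rewrite /horner; elim: (polyseq p) => [|a s IH] /=; first exact: PT_const.
by apply: PT_addn; [apply: PT_muln|exact: PT_const].
Qed.

Lemma PT_expn (A : enctype) k (n : A -> nat) : PT n -> PT (fun x => n x ^ k).
Proof.
move=> Hn; elim: k => [|k IH]; first exact: PT_const.
by apply: (@PT_ext _ _ (fun x => n x * n x ^ k)) => [x|]; [rewrite expnS|apply: PT_muln].
Qed.

(** A loop over the first word strips the second one bit by bit and decides whether the first is a
    prefix of the second; for equal lengths this is equality. *)
Lemma PT_eq_word (A : enctype) (u v : A -> seq bool) :
  PT u -> PT v -> PT (fun x => u x == v x).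
Proof.
move: u v; suff H : PT (fun p : seq bool * seq bool => p.1 == p.2).
  by move=> u v; apply: (PT_comp2 (g := fun u v : seq bool => u == v)).
pose f (q : (seq bool * seq bool) * (seq bool * bool) * bool) :=
  (behead q.1.2.1, q.1.2.2 && branch q.1.2.1 false (~~ q.2) q.2).
have Pf : PT f.
  apply: PT_pair; first by pt.
  by apply: PT_andb; first pt; apply: PT_word_case; try apply: PT_negb; pt.
have E1 p (u v : seq bool) b :
    (foldl (fun a b => f (p, a, b)) (v, b) u).1 = drop (size u) v.
  elim: u v b => [|c u IH] v b /=; first by rewrite drop0.
  by rewrite IH -drop1 drop_drop addn1.
have E2 p (u v : seq bool) b :
    (foldl (fun a b => f (p, a, b)) (v, b) u).2 = b && prefix u v.
  elim: u v b => [|c u IH] v b /=; first by rewrite prefix0s andbT.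
  rewrite IH; case: v => [|d v] /=; first by rewrite andbF.
  by case: b; case: c; case: d.
pose F (p : seq bool * seq bool) := foldl (fun a b => f (p, a, b)) (p.2, true) p.1.
have PF : PT F.
  apply: (PT_foldlW (T := fun w => w + 1) _ _ Pf); pt; auto with polyb.
  move=> [u' v'] j le_j; rewrite [foldl _ _ _]surjective_pairing E1 !wtE size_drop /=; lia.
apply: (@PT_ext _ _ (fun p : seq bool * seq bool => (size p.1 == size p.2) && (F p).2)).
  move=> [u' v'] /=; rewrite /F E2 /=; case: eqP => [Es|ne].
    by rewrite prefixE Es take_size eq_sym.
  by apply/esym/eqP => Euv; apply: ne; rewrite Euv.
by apply: PT_andb; [apply: PT_eqn; apply: PT_size; pt|apply: PT_snd].
Qed.

Lemma PT_flatten (A : enctype) (m : A -> nat) (f : A * nat -> seq bool) :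
  PT m -> PT f -> PT (fun x => flatten [seq f (x, j) | j <- iota 0 (m x)]).
Proof.
move=> Pm Pf; have [km Hm] := PT_bound Pm; have [k Hk] := PT_bound Pf.
pose g (q : A * (nat * seq bool)) := (q.2.1.+1, q.2.2 ++ f (q.1, q.2.1)).
have Pg : PT g.
  apply: PT_pair; first by apply: PT_succn; pt.
  by apply: PT_cat; [pt|apply: (PT_comp Pf); pt].
have E x j : iter j (fun a => g (x, a)) (0, [::]) =
    (j, flatten [seq f (x, i) | i <- iota 0 j]).
  elim: j => // j IH; rewrite iterS IH /g -[in iota 0 j.+1]addn1 iotaD.
  by rewrite map_cat flatten_cat /= cats0.
pose F x := iter (m x) (fun a => g (x, a)) (0, [::]).
have PF : PT F.
  apply: (PT_iter (T := fun w => pb km w + pb km w * pb k (w + pb km w)) Pm _ Pg).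
  - by pt.
  - by auto 10 with polyb.
  move=> x j le_j; rewrite E wt_pair wt_nat wt_word.
  have {}Hm : m x <= pb km (wt (enc x)) by rewrite -[m x]wt_nat.
  apply: leq_add; first exact: leq_trans Hm.
  apply: (@leq_trans (j * pb k (wt (enc x) + pb km (wt (enc x))))); last first.
    by rewrite leq_mul2r (leq_trans le_j Hm) orbT.
  elim: j le_j => // j IH le_j.
  rewrite -[in iota 0 j.+1]addn1 iotaD map_cat flatten_cat /= cats0 size_cat mulSn addnC.
  apply: leq_add; last by apply: IH; lia.
  rewrite -wt_word; apply: leq_trans (Hk (x, j)) _; apply: pb_monor.
  by rewrite wt_pair wt_nat leq_add2l; lia.
apply: (@PT_ext _ _ (fun x => (F x).2)); first by move=> x; rewrite /F E.
by pt.
Qed.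

Lemma PT_isSome (A B : enctype) (o : A -> option B) : PT o -> PT (fun x => isSome (o x)).
Proof.
apply: PT_comp; apply: (PT_branch (i := 0) (f0 := fun=> false) (f1 := fun=> true)
  (f2 := fun=> true)); try exact: PT_const.
by case.
Qed.

Lemma PT_odflt (A : enctype) (o : A -> option (seq bool)) :
  PT o -> PT (fun x => odflt [::] (o x)).
Proof. by apply: PT_comp; apply: (@PT_wire _ _ _ [:: 1]); case. Qed.

(** The first defined value of [f] below [m]. The number of iterations is fixed and a value once
    found is carried to the end, which fits [PT_iter]. *)
Definition search (m : nat) (f : nat -> option bitseq) : option bitseq :=
  (iter m (fun s => (s.1.+1, if isSome s.2 then s.2 else f s.1)) (0, None)).2.

Lemma searchP m f :
  if search m f is Some y then exists2 j, j < m & f j = Some y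
  else forall j, j < m -> f j = None.
Proof.
pose G j := iter j (fun s => (s.1.+1, if isSome s.2 then s.2 else f s.1)) (0, None : option bitseq).
have E j : (G j).1 = j by elim: j => //= j ->.
rewrite /search -/(G m); elim: m => // m; rewrite [G m.+1]/= E.
case: (G m).2 => [y [j lt_j Ej]|H] /=; first by exists j => //; apply: ltnW.
case Em: (f m) => [y|]; first by exists m.
by move=> j; rewrite ltnS leq_eqVlt => /orP[/eqP ->|/H].
Qed.

Lemma PT_search (A : enctype) (m : A -> nat) (f : A * nat -> option (seq bool)) :
  PT m -> PT f -> PT (fun x => search (m x) (fun j => f (x, j))).
Proof.
move=> Pm Pf; have [km Hm] := PT_bound Pm; have [k Hk] := PT_bound Pf.
pose g (q : A * (nat * option (seq bool))) :=
  (q.2.1.+1, if isSome q.2.2 then q.2.2 else f (q.1, q.2.1)).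
have Pg : PT g.
  apply: PT_pair; first by apply: PT_succn; pt.
  by apply: PT_if; [apply: PT_isSome; pt|pt|apply: (PT_comp Pf); pt].
pose G x j := iter j (fun a => g (x, a)) (0, None).
have E1 x j : (G x j).1 = j by elim: j => //= j; rewrite /g /= => ->.
have E2 x j : (G x j).2 = None \/ exists2 i, i < j & (G x j).2 = f (x, i).
  elim: j => [|j IH]; first by left.
  rewrite /G iterS -/(G x j) /g /=; case: IH => [->|[i lt_i ->]] /=.
    by right; exists j; rewrite ?E1.
  by right; case: ifP => _; [exists i => //; apply: ltnW|exists j; rewrite ?E1].
pose F x := G x (m x).
have PF : PT F.
  apply: (PT_iter (T := fun w => pb km w + pb k (w + pb km w)) Pm _ Pg).
  - by pt.
  - by auto 10 with polyb.
  move=> x j le_j; rewrite -/(G x j) [G x j]surjective_pairing E1 wt_pair wt_nat.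
  have {}Hm : m x <= pb km (wt (enc x)) by rewrite -[m x]wt_nat.
  apply: leq_add; first exact: leq_trans Hm.
  case: (E2 x j) => [->|[i lt_i ->]] //.
  apply: leq_trans (Hk (x, i)) _; apply: pb_monor.
  by rewrite wt_pair wt_nat leq_add2l; lia.
by apply: (@PT_ext _ _ (fun x => (F x).2)) => //; pt.
Qed.

(** * Simulation of Turing machines *)

(** A finite table becomes nested tests, each of which strips one bit of the unary code; [minn]
    sends all larger numbers to the last entry. *)
Lemma PT_nat_dispatch (A B : enctype) N (g : nat -> A -> B) :
  (forall i, i <= N -> PT (g i)) -> PT (fun x : nat * A => g (minn x.1 N) x.2).
Proof.
elim: N g => [|N IH] g Hg.
  apply: (@PT_ext _ _ (fun x => g 0 x.2)); first by move=> x; rewrite minn0.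
  by apply: (PT_comp (Hg 0 isT)); pt.
have H0 : PT (fun x : nat * A => g 0 x.2) by apply: (PT_comp (Hg 0 isT)); pt.
have HS : PT (fun x : nat * A => g (minn x.1.-1 N).+1 x.2).
  have H : PT (fun x : nat * A => (x.1.-1, x.2)).
    apply: PT_pair; last by pt.
    apply: PT_unary; apply: (@PT_ext _ _ (fun x => behead (ones x.1))); last by pt.
    by case=> -[].
  by apply: (PT_comp (IH (fun i => g i.+1) _) H) => i le_i; apply: Hg.
apply: (PT_branch (i := 0) H0 HS HS) => -[[|n] x] /=; first by rewrite min0n.
by rewrite minnSS.
Qed.

Definition fin_code (Q : finType) (q : Q) : seq bitseq := [:: ones (enum_rank q)].
Definition fin_enc (Q : finType) := @EncType Q 1 (@fin_code Q) (fun=> erefl).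

Lemma PT_fin_dispatch (A B : enctype) (Q : finType) (g : Q -> A -> B) :
  (forall q, PT (g q)) -> @PT (prod_enc (fin_enc Q) A) B (fun x => g x.1 x.2).
Proof.
move=> Hg; case: (pickP (mem Q)) => [q0 _|Q0]; last first.
  apply: (@PTr_intro _ _ (ar B) id) => [x|||]; auto 10 with polyb.
  - exact: size_enc.
  - by case=> q x; have := Q0 q.
  - by move=> loc b _; exists Skip => s [q x]; have := Q0 q.
have H := @PT_nat_dispatch A B #|Q| (fun i => g (nth q0 (enum Q) i)) (fun i _ => Hg _).
have Hr : @PT (prod_enc (fin_enc Q) A) (prod_enc nat_enc A)
    (fun x => (nat_of_ord (enum_rank x.1), x.2)).
  apply: (@PT_wire _ _ _ (iota 0 (1 + ar A))) => x.
  by rewrite map_nth_iota0 /= ?size_enc ?add1n // take_oversize //= size_enc.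
apply: (PT_ext _ (PT_comp H Hr)) => -[q x] /=.
by rewrite (minn_idPl (ltnW _)) ?nth_enum_rank // ltn_ord.
Qed.

(** A prefix code of the three symbols: the top cell is recognized and removed by reading at most
    two bits. *)
Fixpoint cells_code (s : seq symbol) : bitseq :=
  match s with
  | [::] => [::]
  | None :: s' => false :: cells_code s'
  | Some b :: s' => true :: b :: cells_code s'
  end.

Definition cells := seq symbol.
Canonical cells_enc := @EncType cells 1 (fun s => [:: cells_code s]) (fun=> erefl).
Definition tape_code (t : tape) := [:: cells_code (lcells t); cells_code (rcells t)].
Canonical tape_enc := @EncType tape 2 tape_code (fun=> erefl).

Lemma PT_lcells (A : enctype) (t : A -> tape) : PT t -> @PT A cells_enc (fun x => lcells (t x)).
Proof. by apply: PT_comp; apply: (@PT_wire _ _ _ [:: 0]). Qed.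

Lemma PT_rcells (A : enctype) (t : A -> tape) : PT t -> @PT A cells_enc (fun x => rcells (t x)).
Proof. by apply: PT_comp; apply: (@PT_wire _ _ _ [:: 1]). Qed.

Lemma PT_Tape (A : enctype) (l r : A -> cells) : PT l -> PT r -> PT (fun x => Tape (l x) (r x)).
Proof.
move=> Hl Hr; apply: (PT_comp (g := fun p : cells * cells => Tape p.1 p.2) _ (PT_pair Hl Hr)).
exact: (@PT_wire _ _ _ [:: 0; 1]).
Qed.

Lemma PT_cells_code (A : enctype) (s : A -> cells) : PT s -> PT (fun x => cells_code (s x)).
Proof. by apply: PT_comp; apply: (@PT_wire _ _ _ [:: 0]). Qed.

Lemma PT_cells_uncode (A : enctype) (s : A -> cells) : PT (fun x => cells_code (s x)) -> PT s.
Proof. by []. Qed.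

Lemma PT_behead_cells (A : enctype) (s : A -> cells) :
  PT s -> @PT A cells_enc (fun x => behead (s x)).
Proof.
move=> /PT_cells_code Hs; apply: PT_cells_uncode.
have H1 := PT_behead Hs; have := PT_word_case Hs Hs H1 (PT_behead H1).
by apply: PT_ext => x; case: (s x) => [|[b|] s'].
Qed.

Lemma PT_cons_cells (A : enctype) (a : symbol) (s : A -> cells) :
  PT s -> @PT A cells_enc (fun x => a :: s x).
Proof.
move=> /PT_cells_code Hs; apply: PT_cells_uncode.
by case: a => [b|] /=; pt.
Qed.

Lemma PT_head_dispatch (A B : enctype) (s : A -> cells) (g : symbol -> A -> B) :
  PT s -> (forall a, PT (g a)) -> PT (fun x => g (head None (s x)) x).
Proof.
move=> /PT_cells_code Hs Hg.
have H1 := PT_word_case (PT_behead Hs) (Hg None) (Hg (Some false)) (Hg (Some true)).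
have := PT_word_case Hs (Hg None) (Hg None) H1.
by apply: PT_ext => x; case: (s x) => [|[[]|] s'].
Qed.

Lemma PT_write_move (A : enctype) (t : A -> tape) (a : symbol * move) :
  PT t -> PT (fun x => write_move (t x) a).
Proof.
move=> Ht; have Hl := PT_lcells Ht; have Hr := PT_rcells Ht.
have H0 := PT_cons_cells a.1 (PT_behead_cells Hr).
case: a H0 => a [] /= H0.
- have H := PT_head_dispatch Hl (fun b => PT_Tape (PT_behead_cells Hl) (PT_cons_cells b H0)).
  by apply: (PT_ext _ H) => x; case: (t x).
- by apply: (PT_ext _ (PT_Tape Hl H0)) => x; case: (t x).
- have H := PT_Tape (PT_cons_cells a Hl) (PT_behead_cells Hr).
  by apply: (PT_ext _ H) => x; case: (t x).
Qed.

Section Simulation.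
Variable M : machine.
Let K := (tm_extra M).+1.

Definition tapes_code (ts : K.-tuple tape) : seq bitseq := flatten (map tape_code ts).
Lemma size_tapes_code ts : size (tapes_code ts) = K * 2.
Proof.
rewrite /tapes_code size_flatten /shape -map_comp -[K in RHS](size_tuple ts).
by elim: (tval ts) => //= t l ->.
Qed.
Definition tapes_enc := @EncType (K.-tuple tape) _ tapes_code size_tapes_code.
Definition config_enc := prod_enc (fin_enc (tm_state M)) tapes_enc.

Lemma PT_tnth i : @PT tapes_enc tape_enc (fun ts => tnth ts i).
Proof.
apply: (@PT_wire _ _ _ [:: i * 2; (i * 2).+1]) => ts.
rewrite (tnth_nth (Tape [::] [::])) /= /tapes_code.
have : i < size ts by rewrite size_tuple.
elim: (tval ts) (val i) => //= t l IH [|j] //= lt_j.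
by rewrite IH.
Qed.

Lemma PT_mktapes (A : enctype) (f : 'I_K -> A -> tape) :
  (forall i, PT (f i)) -> @PT A tapes_enc (fun x => [tuple f i x | i < K]).
Proof.
move=> Hf; rewrite /PT.
apply: (@PTr_ext _ (fun x => flatten [seq tape_code (f i x) | i <- enum 'I_K])).
  by move=> x; rewrite /= /tapes_code /= -map_comp.
elim: (enum _) => [|i l IH] /=; first exact: PTr_nil.
exact: (PTr_cat (Hf i) IH).
Qed.

Lemma PT_scan_dispatch (A B : enctype) (ts : A -> K.-tuple tape) l
    (g : seq symbol -> A -> B) :
  @PT A tapes_enc ts -> (forall v, PT (g v)) ->
  PT (fun x => g [seq scanned (tnth (ts x) i) | i <- l] x).
Proof.
move=> Hts; elim: l g => [|i l IH] g Hg /=; first exact: Hg.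
apply: (@PT_head_dispatch _ _ (fun x => rcells (tnth (ts x) i))
  (fun a x => g (a :: [seq scanned (tnth (ts x) i) | i <- l]) x)).
  by apply: PT_rcells; apply: (PT_comp (PT_tnth i) Hts).
by move=> a; apply: (IH (fun v => g (a :: v))).
Qed.

(** The state and the scanned symbols range over finite sets, so a finite case analysis resolves the
    transition; in each case the tapes undergo fixed edits. *)
Lemma PT_step : @PT config_enc config_enc (@step M).
Proof.
apply: (@PT_ext config_enc config_enc (fun x => step ((x.1, x.2) : config M))); first by case.
apply: (@PT_fin_dispatch tapes_enc config_enc (tm_state M)
  (fun q ts => step ((q, ts) : config M))) => q.
rewrite /step /=; case: (tm_halting q) => /=.
  exact: (PT_pair (@PT_const tapes_enc (fin_enc _) q) (PT_id tapes_enc)).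
(* The case analysis ranges over lists of symbols of any length; a list of the wrong length is
   replaced by the blank tuple. *)
pose act (v : seq symbol) :=
  tm_next q (insubd [tuple of nseq _ None] v : (tm_extra M).+1.-tuple symbol).
pose g v (ts : K.-tuple tape) : config M :=
  ((act v).1, [tuple write_move (tnth ts i) (tnth (act v).2 i) | i < K]).
apply: (@PT_ext tapes_enc config_enc (fun ts => g [seq scanned (tnth ts i) | i <- enum 'I_K] ts)).
  move=> ts; have -> : [seq scanned (tnth ts i) | i <- enum 'I_K] = map_tuple scanned ts.
    by rewrite /= -[in RHS](map_tnth_enum ts) -map_comp.
  by rewrite /g /act valKd.
apply: (@PT_scan_dispatch tapes_enc config_enc id); first exact: PT_id.
move=> v; apply: (PT_pair (A := fin_enc _) (B := tapes_enc)).
  exact: (@PT_const tapes_enc (fin_enc _)).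
by apply: PT_mktapes => i; apply: PT_write_move; apply: PT_tnth.
Qed.

Lemma wt_write_move t a : wt (tape_code (write_move t a)) <= wt (tape_code t) + 4.
Proof.
have size_cons b s : size (cells_code (b :: s)) <= 2 + size (cells_code s).
  by case: b.
have size_beh s : size (cells_code (behead s)) <= size (cells_code s).
  by case: s => [|[b|] s] //=; lia.
have size_hd s : size (cells_code (head None s :: behead s)) <= (size (cells_code s)).+1.
  by case: s => [|b s] //=.
case: t a => l r [b []] /=; rewrite !wt_cons !addn0.
- have := size_cons b (behead r); have := size_beh r; have := size_hd l.
  have := size_beh l; case: (head None l) => [c|] /=; lia.
- by have := size_cons b (behead r); have := size_beh r; rewrite /=; lia.
- by have := size_cons b l; have := size_beh r; rewrite /=; lia.
Qed.

Lemma wt_tapes (ts : K.-tuple tape) :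
  wt (tapes_code ts) = \sum_(i < K) wt (tape_code (tnth ts i)).
Proof.
rewrite -(big_tuple _ _ ts predT (fun t => wt (tape_code t))) /tapes_code.
elim: (tval ts) => [|t l IH]; first by rewrite big_nil.
by rewrite big_cons -IH /= -wt_cat.
Qed.

Lemma wt_step (c : config M) : wt (tapes_code (step c).2) <= wt (tapes_code c.2) + K * 4.
Proof.
rewrite /step; case: ifP => _; first exact: leq_addr.
rewrite !wt_tapes -[K in K * 4]card_ord -sum_nat_const -big_split /=.
by apply: leq_sum => i _; rewrite tnth_mktuple wt_write_move.
Qed.

(** A step lengthens the tapes by a constant at most, so polynomially many steps keep the
    configuration polynomial, as iteration requires. The state, coded in unary by its rank, costs at
    most the number of states. *)
Lemma wt_steps n (c : config M) :
  wt (@enc config_enc (iter n (@step M) c)) <=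
  #|tm_state M| + (wt (@enc config_enc c) + n * (K * 4)).
Proof.
have H : wt (tapes_code (iter n (@step M) c).2) <= wt (tapes_code c.2) + n * (K * 4).
  elim: n => [|n IH] /=; first by rewrite addn0.
  apply: leq_trans (wt_step _) _; by rewrite mulSn [K * 4 + _]addnC addnA leq_add2r.
rewrite /= !wt_cons; apply: leq_add.
  by rewrite size_nseq ltnW // ltn_ord.
by apply: leq_trans H _; rewrite leq_add2r leq_addl.
Qed.

Lemma PT_run (A : enctype) (n : A -> nat) (c : A -> config M) :
  PT n -> @PT A config_enc c -> @PT A config_enc (fun x => iter (n x) (@step M) (c x)).
Proof.
move=> Pn Pc; have [kn Hn] := PT_bound Pn; have [k Hk] := PT_bound Pc.
pose T w := #|tm_state M| + (pb k w + pb kn w * (K * 4)).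
apply: (@PT_iter A config_enc n c (fun q => step q.2) T Pn Pc).
- exact: (PT_comp PT_step (PT_snd (PT_id (prod_enc A config_enc)))).
- by rewrite /T; auto 10 with polyb.
- move=> x j le_j; apply: leq_trans (wt_steps _ _) _; rewrite /T leq_add2l leq_add //.
  by rewrite leq_mul2r; apply/orP; right; apply: leq_trans le_j _; rewrite -[n x]wt_nat.
Qed.

Lemma PT_tape_of_word (A : enctype) (w : A -> seq bool) :
  PT w -> PT (fun x => tape_of_word (w x)).
Proof.
move=> Pw; apply: (PT_Tape (PT_const A (B := cells_enc) [::])); apply: PT_cells_uncode.
apply: (PT_comp (g := fun v : seq bool => cells_code (map Some v)) _ Pw).
pose f (q : seq bool * seq bool * bool) := true :: q.2 :: q.1.2.
have E p (v a : seq bool) : foldl (fun a b => f (p, a, b)) a v =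
    cells_code (map Some (rev v)) ++ a.
  elim: v a => //= b v IH a; rewrite IH rev_cons map_rcons /f /=.
  by elim: (rev v) => //= c u ->.
apply: (@PT_ext _ _ (fun v => foldl (fun a b => f (v, a, b)) [::] (rev v))).
  by move=> v; rewrite E revK cats0.
apply: (PT_foldlW (T := fun w => 2 * w)); rewrite /f; pt; auto with polyb.
  by apply: PT_rev; pt.
have size_code v : size (cells_code (map Some v)) = 2 * size v.
  by elim: v => //= b v ->; rewrite mulnS.
move=> v j le_j; rewrite -/f (E v) cats0 wt_word size_code size_rev -wt_word.
rewrite leq_mul2l /= wt_word size_take_min (leq_trans (geq_minr _ _)) //.
by rewrite size_rev wt_word.
Qed.

Lemma PT_initial (A : enctype) : @PT A config_enc (fun x => @initial M (enc x)).
Proof.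
apply: (PT_pair (@PT_const A (fin_enc _) _)).
apply: PT_mktapes => i; apply: PT_tape_of_word; exact: (PTr_reg A i).
Qed.

(** Each pass moves one symbol onto a reversed word, and the loop idles at the first blank; any
    number of passes at least the length of the word will do, and the length of the code is such a
    number. *)
Lemma PT_word_of_cells (A : enctype) (s : A -> cells) :
  PT s -> PT (fun x => word_of_cells (s x)).
Proof.
apply: PT_comp.
pose g (a : symbol) (q : cells * seq bool) : cells * seq bool :=
  if a is Some b then (behead q.1, b :: q.2) else q.
pose f (p : cells * (cells * seq bool)) := g (head None p.2.1) p.2.
have Pf : @PT (prod_enc cells_enc (prod_enc cells_enc word_enc)) (prod_enc cells_enc word_enc) f.
  apply: (PT_comp (g := fun q : cells * seq bool => g (head None q.1) q)).
    apply: PT_head_dispatch => [|[b|]]; [by pt| |exact: PT_id].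
    by apply: PT_pair; [apply: PT_behead_cells; pt|pt].
  by pt.
pose h q := g (head None q.1) q.
have E n r a : size (word_of_cells r) <= n ->
    (iter n h (r, a)).2 = rev (word_of_cells r) ++ a.
  elim: n r a => [|n IH] r a; first by case: r => [|[b|] r].
  rewrite iterSr; case: r => [|[b|] r] /= le_n; rewrite /h /=; try exact: IH.
  by rewrite rev_cons cat_rcons; apply: IH.
have E1 n r a : size (cells_code (iter n h (r, a)).1) <= size (cells_code r).
  elim: n => //= n; apply: leq_trans; rewrite /h /g.
  by case: (iter _ _ _) => [[|[b|] r'] a'] //=; lia.
have E2 n r a : size (iter n h (r, a)).2 <= n + size a.
  elim: n => //= n IH; rewrite /h /g.
  by case: (iter n _ _) IH => [[|[b|] r'] a'] /=; lia.
have size_word r : size (word_of_cells r) <= size (cells_code r).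
  by elim: r => //= -[b|] r IH //=; lia.
pose F (r : cells) := iter (size (cells_code r)) (fun a => f (r, a)) (r, [::]).
have PF : @PT cells_enc (prod_enc cells_enc word_enc) F.
  apply: (@PT_iter _ _ _ _ f (fun w => w + w)) => //; auto with polyb.
  - by apply: PT_size; apply: PT_cells_code; pt.
  - by pt.
  move=> r j le_j; rewrite [iter _ _ _]surjective_pairing wt_pair wt_word.
  rewrite !wt_cons !addn0; apply: leq_add; first exact: E1.
  by apply: leq_trans (E2 _ _ _) _; rewrite addn0.
apply: (@PT_ext cells_enc _ (fun r => rev (F r).2)).
  by move=> r; rewrite [(F r).2]E // cats0 revK.
by apply: PT_rev; apply: PT_snd.
Qed.

Lemma PT_output (A : enctype) (c : A -> config M) :
  @PT A config_enc c -> PT (fun x => output (c x)).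
Proof.
apply: PT_comp.
apply: (@PT_ext config_enc _ (fun x => output ((x.1, x.2) : config M))); first by case.
apply: (@PT_fin_dispatch tapes_enc _ (tm_state M) (fun q ts => output ((q, ts) : config M))) => q.
rewrite /output /=; case: (tm_accepting q); last exact: PT_const.
by apply: PT_Some; apply: PT_word_of_cells; apply: PT_rcells; apply: PT_tnth.
Qed.

Lemma PT_simulate (A : enctype) (n : A -> nat) :
  PT n -> PT (fun x => output (iter (n x) (@step M) (initial M (enc x)))).
Proof. by move=> Pn; apply: PT_output; apply: PT_run => //; apply: PT_initial. Qed.

End Simulation.

(** * Between machines and functions on encoded types *)

Lemma PT_poly_time F : poly_time F -> PT (F : seq bool -> seq bool).
Proof.
case=> M [p HM]; apply: (@PT_ext _ _ (fun x : seq bool =>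
  odflt [::] (output (iter p.[size x]%R (@step M) (initial M (enc x)))))).
  by move=> x; have [_ ->] := HM x.
by apply: PT_odflt; apply: PT_simulate; apply: PT_horner; apply: PT_size; pt.
Qed.

(** The value and its definedness flag are computed above the arguments; discarding the arguments
    brings these two words to registers 0 and 1, as [machine_of_cmd] expects. *)
Lemma PT_machine (A : enctype) (f : A -> option (seq bool)) : PT f ->
  exists (M : machine) k, forall x, computes_within M (pb k (wt (enc x))) (enc x) (f x).
Proof.
move=> Pf.
have Ph : PTr (fun x => [:: odflt [::] (f x); [:: isSome (f x)]]).
  have H := PTr_cat (PT_odflt Pf) (PT_word_of_bool (PT_isSome Pf)); exact: H.
have [_ [k [Hk Hc]]] := Ph.
have [|c {}Hc] := Hc (iota 0 (ar A)) (ar A); first exact: all_gtn_iota.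
have [M HM] := machine_of_cmd (Seq c (discard 0 (ar A) 2)).
pose T w := pb k w + (3 * w + ar A + 20 * (pb k w + 2)) + 1.
have [l Hl] : polyb T by rewrite /T; auto 10 with polyb.
exists M, l => x; set w := wt (enc x).
pose s : store := nth [::] (enc x).
have Hs : [seq s i | i <- iota 0 (ar A)] = enc x.
  by rewrite map_nth_iota0 ?size_enc // -(size_enc x) take_size.
have Hf : fresh s (ar A) by move=> i le_i; rewrite /s nth_default // size_enc.
have H1 := Hc s x Hs Hf.
have E : place s (ar A) [:: odflt [::] (f x); [:: isSome (f x)]] =
    place s 0 (enc x ++ [:: odflt [::] (f x); [:: isSome (f x)]]).
  rewrite -place_cat add0n size_enc; congr place.
  by apply/funext => i; rewrite /place ltn0 subn0.
rewrite E in H1.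
have [t le_t Ht] := bexec_Seq H1 (@discardP s 0 (enc x)
  [:: odflt [::] (f x); [:: isSome (f x)]] _ 2 (size_enc x) erefl).
have := HM _ _ _ Ht; rewrite /computes_within.
have -> : (if place s 0 [:: odflt [::] (f x); [:: isSome (f x)]] 1 is true :: _
   then Some (place s 0 [:: odflt [::] (f x); [:: isSome (f x)]] 0) else None) = f x.
  by rewrite /place /=; case: (f x).
have le_tl : t.+1 <= pb l w.
  apply: leq_trans (Hl w); rewrite /T addn1 ltnS; apply: leq_trans le_t _.
  by rewrite leq_add2l leq_add2l leq_mul2l leq_add2r Hk.
(* A halted configuration is fixed by [step], so the running time can be raised to the bound. *)
rewrite -(subnK le_tl) iterD; case=> Hh Ho.
have -> : iter (pb l w - t.+1) (@step M) (iter t.+1 (@step M) (initial M (enc x)))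
    = iter t.+1 (@step M) (initial M (enc x)).
  move: (iter t.+1 _ _) Hh => cf Hh; elim: (_ - _) => //= n ->.
  by rewrite /step Hh.
by split.
Qed.

Lemma pb_polyP k : exists p : {poly nat}, forall w, p.[w]%R = pb k w.
Proof.
exists (('X + (2%N)%:P) ^+ k)%R => w.
by rewrite horner_exp hornerD hornerX hornerC natrXE natrDE addn2.
Qed.

Lemma poly_time_PT F : PT (F : seq bool -> seq bool) -> poly_time F.
Proof.
move=> PF; have [M [k HM]] := PT_machine (PT_Some PF).
have [p Hp] := pb_polyP k; exists M, p => x.
by rewrite Hp; have := HM x; rewrite wt_word.
Qed.

Lemma horner_mono (p : {poly nat}) m n : m <= n -> p.[m]%R <= p.[n]%R.
Proof.
move=> le_mn; rewrite /horner; elim: (polyseq p) => //= a s IH.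
by apply: leq_add => //; apply: leq_mul.
Qed.

(** The random bits count in the encoding but not in the bound of [ppt]. Their number [q.[n]] is at
    most [q.[n + size y]], so adding [q] to the polynomial makes up for them. *)
Lemma ppt_PT (q : {poly nat}) (f : seq bool * seq bool * seq bool -> option (seq bool)) :
  PT f -> ppt q f.
Proof.
move=> Pf; have [M [k HM]] := PT_machine Pf.
exists M, (('X + q + (2%N)%:P) ^+ k)%R => n y r sz_r.
have := HM (ones n, y, r); rewrite /computes_within => -[].
set T := pb _ _; set T' := (_.[_])%R => Hh Ho.
have le_T : T <= T'.
  rewrite /T' horner_exp !hornerD hornerX hornerC natrXE !natrDE; apply: leq_expl.
  rewrite !wtE size_nseq sz_r -addn2 leq_add2r leq_add2l.
  by apply: horner_mono; apply: leq_addr.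
rewrite -(subnK le_T) iterD.
have -> : iter (T' - T) (@step M) (iter T (@step M) (initial M [:: ones n; y; r])) =
    iter T (@step M) (initial M [:: ones n; y; r]).
  move: (iter T _ _) Hh => cf Hh; elim: (_ - _) => //= i ->.
  by rewrite /step Hh.
by split.
Qed.

(** Nothing is known of [G] when the number of random bits is wrong. It is replaced by the clocked
    run of its machine, which agrees with it on all genuine challenges. *)
Lemma PT_ppt q G : ppt q G ->
  exists2 G' : seq bool * seq bool * seq bool -> option (seq bool), PT G' &
    forall n y r, size r = q.[n]%R -> G' (ones n, y, r) = G (ones n, y, r).
Proof.
case=> M [p HM].
exists (fun x => output (iter p.[size x.1.1 + size x.1.2]%R (@step M)
  (initial M (enc (x : seq bool * seq bool * seq bool))))).
  apply: PT_simulate; apply: PT_horner; apply: PT_addn; apply: PT_size; pt.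
move=> n y r sz_r; have [_ <-] := HM n y r sz_r.
by rewrite /= size_nseq.
Qed.

(** * The amplified function and the inverter *)

Definition block n j (z : bitseq) := take n (drop (j * n) z).

(* The integer part of the K-th root. *)
Definition kroot K N :=
  size (flatten [seq if j.+1 ^ K <= N then [:: true] else [::] | j <- iota 0 N]).

(** The condition counted by [kroot] is downward closed in [j], so the number of its solutions is
    the least [j] that violates it; none of the solutions reaches [N]. *)
Lemma krootP K N : 0 < K -> kroot K N ^ K <= N < (kroot K N).+1 ^ K.
Proof.
move=> K_gt0; pose P j := j.+1 ^ K <= N.
have exP : exists j, ~~ P j.
  by exists N; rewrite /P -ltnNge -{1}(expn1 N.+1) leq_pexp2l.
pose n := ex_minn exP.
have [nPn minP] : ~~ P n /\ forall j, ~~ P j -> n <= j by rewrite /n; case: ex_minnP.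
have PP j : P j = (j < n).
  apply/idP/idP => [Pj|lt_j]; last by apply: contraLR lt_j => /minP; rewrite -leqNgt.
  rewrite ltnNge; apply: contra nPn => le_nj; apply: leq_trans Pj.
  by apply: leq_expl.
have le_nN : n <= N.
  by apply: minP; rewrite /P -ltnNge -{1}(expn1 N.+1) leq_pexp2l.
have -> : kroot K N = n.
  have E l : size (flatten [seq if j.+1 ^ K <= N then [:: true] else [::] | j <- l]) = count P l.
    by elim: l => //= j l IH; rewrite size_cat IH /P; case: ifP.
  rewrite /kroot E (eq_count PP) -(subnKC le_nN) iotaD count_cat add0n.
  rewrite (eq_in_count (a2 := predT)) => [|j]; last by rewrite mem_iota => /andP[].
  rewrite (eq_in_count (a2 := pred0) (s := iota n _)) => [|j]; last first.
    by rewrite mem_iota [j < n]ltnNge => /andP[->].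
  by rewrite count_predT count_pred0 size_iota addn0.
rewrite ltnNge nPn andbT; case: (n) PP => [|n'] PP; first by rewrite exp0n.
by rewrite -/(P n') PP.
Qed.

Section Amplification.
Variables (F e : bitseq -> bitseq) (k : nat).

Definition amp n m z :=
  flatten [seq e (F (block n j z)) | j <- iota 0 m] ++ drop (m * n) z.

(* [amp n m z] with the [i]-th block replaced by a preimage of [y]. *)
Definition amp_at n m i y z :=
  flatten [seq if j == i then e y else e (F (block n j z)) | j <- iota 0 m]
  ++ drop (m * n) z.

Definition repl n i x (z : bitseq) := take (i * n) z ++ x ++ drop (i * n + n) z.

Lemma size_repl n m i x z : i < m -> m * n <= size z -> size x = n ->
  size (repl n i x z) = size z.
Proof.
move=> lt_i le_z sz_x; rewrite !size_cat sz_x size_drop size_takel; last by nia.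
suff: i * n + n <= size z by lia.
by nia.
Qed.

Lemma block_cat3 n i j u v v' w : size u = i * n -> size v = n -> size v' = n ->
  block n j (u ++ v ++ w) = if j == i then v else block n j (u ++ v' ++ w).
Proof.
case: (posnP n) => [-> _ /size0nil -> _|n_gt0 sz_u sz_v sz_v'].
  by rewrite /block !take0 if_same.
rewrite /block; case: (ltngtP j i) => [lt_j|gt_j|->].
- have le_j : n <= size (drop (j * n) u) by rewrite size_drop sz_u; nia.
  by rewrite !drop_cat sz_u ltn_pmul2r // lt_j !takel_cat.
- have le_j : i * n + n <= j * n by nia.
  by rewrite !catA !drop_cat !size_cat sz_u sz_v sz_v' ltnNge le_j.
- by rewrite drop_size_cat // take_size_cat.
Qed.

Lemma block_repl n m i x z j : i < m -> m * n <= size z -> size x = n ->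
  block n j (repl n i x z) = if j == i then x else block n j z.
Proof.
move=> lt_i le_z sz_x; have le_i : i * n + n <= size z by nia.
have sz_u : size (take (i * n) z) = i * n by rewrite size_takel //; lia.
have sz_v : size (take n (drop (i * n) z)) = n by rewrite size_takel // size_drop; lia.
rewrite /repl (block_cat3 _ _ sz_u sz_x sz_v) [i * n + n]addnC -drop_drop.
by rewrite !cat_take_drop.
Qed.

Lemma drop_repl n m i x z : i < m -> m * n <= size z -> size x = n ->
  drop (m * n) (repl n i x z) = drop (m * n) z.
Proof.
move=> lt_i le_z sz_x; have le_i : i * n + n <= size z by nia.
have le_m : i * n + n <= m * n by nia.
have sz_u : size (take (i * n) z) = i * n by rewrite size_takel //; lia.
rewrite /repl catA drop_cat size_cat sz_u sz_x ltnNge le_m /= drop_drop.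
by rewrite subnK.
Qed.

(** The right-hand side depends on [x] through [F x] only: whoever is given [F x] can build this
    challenge without knowing [x]. *)
Lemma amp_repl n m i x z : i < m -> m * n <= size z -> size x = n ->
  amp n m (repl n i x z) = amp_at n m i (F x) z.
Proof.
move=> lt_i le_z sz_x; rewrite /amp /amp_at (drop_repl lt_i) //; congr (flatten _ ++ _).
by apply: eq_map => j; rewrite (block_repl _ lt_i) //; case: eqP.
Qed.

(** Unambiguous concatenation, for arguments of equal length only: this is what makes the identity
    admissible when [F] preserves lengths. *)
Definition decodable := forall u v a b, size u = size v ->
  e (F u) ++ a = e (F v) ++ b -> F u = F v /\ a = b.

Lemma amp_decode n m z z' : decodable -> size z = size z' -> amp n m z = amp n m z' ->
  (forall i, i < m -> F (block n i z) = F (block n i z')) /\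
  drop (m * n) z = drop (m * n) z'.
Proof.
move=> dec sz_z; rewrite /amp; move: (drop _ z) (drop _ z') => a b.
suff H l : flatten [seq e (F (block n j z)) | j <- l] ++ a =
    flatten [seq e (F (block n j z')) | j <- l] ++ b ->
    (forall i, i \in l -> F (block n i z) = F (block n i z')) /\ a = b.
  by move=> /H[H1 ->]; split=> // i lt_i; apply: H1; rewrite mem_iota.
elim: l => [|j l IH] //=; rewrite -!catA => /dec[|Ej /IH[El ->]].
  by rewrite /block !size_take_min !size_drop sz_z.
by split=> // i; rewrite inE => /orP[/eqP ->|/El].
Qed.

(* The exponents: [n ^ k.+1] blocks of length [n] fit in a word whose length is
   at least [n ^ k.+2]. *)
Definition amplify z := let n := kroot k.+2 (size z) in amp n (n ^ k.+1) z.

Lemma kroot_blocks N : kroot k.+2 N ^ k.+1 * kroot k.+2 N <= N.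
Proof. by rewrite -expnSr; have /andP[] := krootP N (isT : 0 < k.+2). Qed.

Section Inverter.
Variables (q : {poly nat}) (G : bitseq * bitseq * bitseq -> option bitseq) (d : nat).

(** A length [N = n ^ k.+2 + t] with root [n] is below this number, hence so is [t]. Values of [t]
    that lead to another root are harmless. *)
Definition tails n := n.+1 ^ k.+2.
Definition rounds n := n.+1 ^ d.
(** Random bits reserved for one trial: [N] for the word and [q.[N]] for [G], with [N] replaced by
    an upper bound so that all trials have chunks of the same length. *)
Definition chunk n := (n ^ k.+2 + tails n) + q.[(n ^ k.+2 + tails n)%N]%R.

(* One round for the position [i] of the challenge [y] and the tail length [t]. *)
Definition trial n y r i t s :=
  let N := n ^ k.+2 + t in
  let rho := drop (((i * tails n + t) * rounds n + s) * chunk n) r in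
  let z := take N rho in
  let w := odflt [::] (G (ones N, amp_at n (n ^ k.+1) i y z, take q.[N]%R (drop N rho))) in
  let x := block n i w in
  if (size x == n) && (F x == y) then Some x else None.

(** Neither the position that is favourable to [x] nor the relevant tail length is known, so all are
    tried. Every triple [(i, t, s)] in range has its own chunk of the random bits. *)
Definition inverter (a : bitseq * bitseq * bitseq) : option bitseq :=
  let n := size a.1.1 in
  search (n ^ k.+1) (fun i => search (tails n) (fun t => search (rounds n) (fun s =>
    trial n a.1.2 a.2 i t s))).

(** Whatever a trial returns has been checked to be a preimage of the right length, so the inverter
    fails only if every trial returns nothing. *)
Lemma inverterP n x r : size x = n -> ~~ inverts F inverter (ones n, F x, r) ->
  forall i t s, i < n ^ k.+1 -> t < tails n -> s < rounds n ->
  trial n (F x) r i t s = None.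
Proof.
move=> sz_x; rewrite /inverts /inverter /= size_nseq => Hinv.
set f := fun i => search (tails n) _ in Hinv.
have trialP i t s x' : trial n (F x) r i t s = Some x' -> size x' = n /\ F x' = F x.
  by rewrite /trial /=; case: ifP => // /andP[/eqP E1 /eqP E2] [<-].
have fP i x' : f i = Some x' -> size x' = n /\ F x' = F x.
  rewrite /f => E; have := searchP (tails n) (fun t => search (rounds n)
    (fun s => trial n (F x) r i t s)); rewrite E => -[t _ Et].
  have := searchP (rounds n) (fun s => trial n (F x) r i t s); rewrite Et => -[s _].
  exact: trialP.
have := searchP (n ^ k.+1) f; case E: (search _ f) Hinv => [x'|] /= Hinv.
  by case=> i _ /fP[sz_x' Fx']; rewrite /auxiliary sz_x' Fx' eqxx in Hinv.
move=> fN i t s lt_i lt_t lt_s; have := fN i lt_i; rewrite /f => Ei.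
have := searchP (tails n) (fun t => search (rounds n)
    (fun s => trial n (F x) r i t s)); rewrite Ei => /(_ t lt_t) Et.
by have := searchP (rounds n) (fun s => trial n (F x) r i t s); rewrite Et; apply.
Qed.

(** The component [ones N] of the challenge forces a preimage to have length [N], hence the same
    division into blocks; by [amp_decode] its block [i] is then mapped to [F x]. *)
Lemma trial_success n x r i t s : let N := n ^ k.+2 + t in
  let rho := drop (((i * tails n + t) * rounds n + s) * chunk n) r in
  let z := repl n i x (take N rho) in
  decodable -> kroot k.+2 N = n -> size x = n -> i < n ^ k.+1 -> N <= size rho ->
  inverts amplify G (ones N, amplify z, take q.[N]%R (drop N rho)) ->
  trial n (F x) r i t s <> None.
Proof.
move=> N rho z dec rootN sz_x lt_i le_N.
have sz_r : size (take N rho) = N by rewrite size_takel.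
have le_b : n ^ k.+1 * n <= N by rewrite -rootN; apply: kroot_blocks.
have sz_z : size z = N by rewrite (size_repl lt_i) ?sz_r.
have ampz : amplify z = amp_at n (n ^ k.+1) i (F x) (take N rho).
  by rewrite /amplify sz_z rootN amp_repl // sz_r.
rewrite /inverts /= /trial -/N -/rho -ampz.
case: (G _) => [w|] //= /eqP[Ew Aw].
have sz_w : size w = N by have := congr1 size Ew; rewrite !size_nseq.
have [||E _] := @amp_decode n (n ^ k.+1) w z dec.
- by rewrite sz_w.
- by move: Aw; rewrite /amplify sz_w sz_z rootN.
have sz_b : size (block n i w) = n by rewrite size_takel // size_drop sz_w; nia.
rewrite sz_b eqxx E // (block_repl _ lt_i) ?sz_r // eqxx.
by rewrite eqxx.
Qed.

End Inverter.
End Amplification.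

(** * Polynomial time of the amplified function and of the inverter *)

Lemma PT_block (A : enctype) (n j : A -> nat) (z : A -> seq bool) :
  PT n -> PT j -> PT z -> PT (fun x => block (n x) (j x) (z x)).
Proof. by move=> Pn Pj Pz; apply: PT_take => //; apply: PT_drop => //; apply: PT_muln. Qed.

Lemma PT_kroot (A : enctype) K (N : A -> nat) : PT N -> PT (fun x => kroot K (N x)).
Proof.
move=> PN; apply: PT_size.
apply: (PT_flatten (f := fun q => if q.2.+1 ^ K <= N q.1 then [:: true] else [::])) => //.
apply: PT_if; [|exact: PT_const|exact: PT_const].
apply: PT_leq; first by apply: PT_expn; apply: PT_succn; pt.
by apply: (PT_comp PN); pt.
Qed.

Lemma PT_amp_at (A : enctype) F e (n m i : A -> nat) (y z : A -> seq bool) :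
  PT (F : seq bool -> seq bool) -> PT (e : seq bool -> seq bool) ->
  PT n -> PT m -> PT i -> PT y -> PT z ->
  PT (fun x => amp_at F e (n x) (m x) (i x) (y x) (z x)).
Proof.
move=> PF Pe Pn Pm Pi Py Pz; have P1 : PT (fst : A * nat -> A) by pt.
have P2 : PT (snd : A * nat -> nat) by pt.
apply: PT_cat; last by apply: PT_drop => //; apply: PT_muln.
apply: (PT_flatten (f := fun q => if q.2 == i q.1 then e (y q.1)
  else e (F (block (n q.1) q.2 (z q.1))))) => //.
apply: PT_if; first by apply: PT_eqn => //; apply: (PT_comp Pi).
  by apply: (PT_comp Pe); apply: (PT_comp Py).
apply: (PT_comp Pe); apply: (PT_comp PF); apply: PT_block => //.
  exact: (PT_comp Pn P1).
exact: (PT_comp Pz P1).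
Qed.

Lemma PT_amplify F e k : PT (F : seq bool -> seq bool) -> PT (e : seq bool -> seq bool) ->
  PT (amplify F e k : seq bool -> seq bool).
Proof.
move=> PF Pe; have Pn : PT (fun z : seq bool => kroot k.+2 (size z)).
  by apply: PT_kroot; apply: PT_size; pt.
apply: (@PT_ext _ _ (fun z : seq bool => let n := kroot k.+2 (size z) in
   amp_at F e n (n ^ k.+1) (n ^ k.+1) [::] z)).
  move=> z; rewrite /amplify /amp_at /amp; set m := _ ^ _.
  congr (flatten _ ++ _); apply/eq_in_map => j; rewrite mem_iota => /andP[_ lt_j].
  by rewrite ltn_eqF.
apply: (PT_amp_at PF Pe Pn (PT_expn _ Pn) (PT_expn _ Pn) (PT_const _ _)); exact: PT_id.
Qed.

Lemma PT_chunk (A : enctype) k q (n : A -> nat) : PT n -> PT (fun x => chunk k q (n x)).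
Proof.
move=> Pn; have P : PT (fun x => n x ^ k.+2 + tails k (n x)).
  by apply: PT_addn; apply: PT_expn => //; apply: PT_succn.
by apply: PT_addn => //; apply: (PT_horner q P).
Qed.

Lemma PT_inverter F e k q G d : PT (F : seq bool -> seq bool) ->
  PT (e : seq bool -> seq bool) ->
  PT (G : seq bool * seq bool * seq bool -> option (seq bool)) ->
  PT (inverter F e k q G d : seq bool * seq bool * seq bool -> option (seq bool)).
Proof.
move=> PF Pe PG; pose X := (seq bool * seq bool * seq bool * nat * nat * nat)%type.
pose n (x : X) := size x.1.1.1.1.1.
have Pn : PT n by apply: PT_size; pt.
pose N x := n x ^ k.+2 + x.1.2.
have PN : PT N by apply: PT_addn; [apply: PT_expn|pt].
pose rho x := drop (((x.1.1.2 * tails k (n x) + x.1.2) * rounds d (n x) + x.2) *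
  chunk k q (n x)) x.1.1.1.2.
have Ptails : PT (fun x => tails k (n x)) by apply: PT_expn; apply: PT_succn.
have Prounds : PT (fun x => rounds d (n x)) by apply: PT_expn; apply: PT_succn.
have Pi : PT (fun x : X => x.1.1.2) by pt.
have Prho : PT rho.
  apply: PT_drop; last by pt.
  apply: PT_muln; last exact: PT_chunk.
  apply: PT_addn; last by pt.
  by apply: PT_muln => //; apply: PT_addn; [apply: PT_muln|pt].
pose w x := odflt [::] (G (ones (N x),
  amp_at F e (n x) (n x ^ k.+1) x.1.1.2 x.1.1.1.1.2 (take (N x) (rho x)),
  take q.[N x]%R (drop (N x) (rho x)))).
have Pw : PT w.
  apply: PT_odflt; apply: (PT_comp PG); apply: PT_pair; last first.
    by apply: PT_take; [apply: (PT_horner q PN)|apply: PT_drop].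
  apply: PT_pair; first exact: PT_ones.
  apply: PT_amp_at => //; [exact: PT_expn|pt|exact: PT_take].
pose b x := block (n x) x.1.1.2 (w x).
have Pb : PT b by apply: PT_block.
have Ptrial : PT (fun x : X => trial F e k q G d (n x) x.1.1.1.1.2 x.1.1.1.2 x.1.1.2 x.1.2 x.2).
  apply: (@PT_ext _ _ (fun x => if (size (b x) == n x) && (F (b x) == x.1.1.1.1.2)
    then Some (b x) else None)) => //.
  apply: PT_if; [|exact: PT_Some|exact: PT_const].
  apply: PT_andb; first by apply: PT_eqn => //; apply: PT_size.
  by apply: PT_eq_word; [apply: (PT_comp PF)|pt].
have P1 := PT_search (A := prod_enc (prod_enc (prod_enc (prod_enc word_enc word_enc) word_enc)
   nat_enc) nat_enc) (m := fun x => rounds d (size x.1.1.1.1)) _ Ptrial.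
have P2 := PT_search (A := prod_enc (prod_enc (prod_enc word_enc word_enc) word_enc)
   nat_enc) (m := fun x => tails k (size x.1.1.1)) _ (P1 _).
apply: (PT_search (A := prod_enc (prod_enc word_enc word_enc) word_enc)
   (m := fun x => size x.1.1 ^ k.+1) _ (P2 _ _)).
- by apply: PT_expn; apply: PT_size; pt.
- by apply: PT_expn; apply: PT_succn; apply: PT_size; pt.
- by apply: PT_expn; apply: PT_succn; apply: PT_size; pt.
Qed.

(** The prefix code of the cells of [w] followed by a blank, which marks the end. *)
Definition delimit (w : bitseq) : bitseq := cells_code (map Some w) ++ [:: false].

Lemma PT_delimit : PT (delimit : seq bool -> seq bool).
Proof.
apply: PT_cat; last exact: PT_const.
exact: (PT_cells_code (PT_rcells (PT_tape_of_word (PT_id word_enc)))).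
Qed.

Lemma delimit_decodable F : decodable F delimit.
Proof.
move=> u v a b _; rewrite /delimit -!catA /=.
elim: (F u) (F v) => [|c w IH] [|c' w'] //=; first by case=> ->.
by case=> -> /IH[-> ->].
Qed.

(** * Amplification of a permutation *)

Section LengthPermutation.
Variables (F : bitseq -> bitseq) (k : nat).
Hypothesis permF : length_permutation F.

Lemma permF_size x : size (F x) = size x.
Proof. by have [funF _ _] := permF (size x); apply: (funF x). Qed.

Lemma id_decodable : decodable F id.
Proof.
move=> u v a b sz /eqP; rewrite eqseq_cat ?permF_size // => /andP[/eqP-> /eqP->].
by split.
Qed.

Lemma flatten_blocks n m z :
  flatten [seq block n j z | j <- iota 0 m] ++ drop (m * n) z = z.
Proof.
elim: m => [|m IH]; first by rewrite drop0.
rewrite -addn1 iotaD map_cat flatten_cat /= cats0 -catA addn1 mulSn -drop_drop.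
by rewrite cat_take_drop.
Qed.

Lemma amplify_size z : size (amplify F id k z) = size z.
Proof.
rewrite /amplify /amp; set n := kroot _ _; set m := n ^ _.
rewrite -[in RHS](flatten_blocks n m z) !size_cat !size_flatten; congr (sumn _ + _).
by rewrite /shape -!map_comp; apply: eq_map => j /=; rewrite permF_size.
Qed.

Lemma amplify_inj z z' : size z = size z' -> amplify F id k z = amplify F id k z' -> z = z'.
Proof.
move=> sz; rewrite /amplify -sz; set n := kroot _ _; set m := n ^ _ => E.
have le_m : m * n <= size z by apply: kroot_blocks.
have [Eb Ed] := amp_decode id_decodable sz E.
rewrite -(flatten_blocks n m z) -(flatten_blocks n m z') Ed; congr (flatten _ ++ _).
apply/eq_in_map => j; rewrite mem_iota => /andP[_ lt_j].
have szb y : size y = size z -> size (block n j y) = n.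
  by move=> sz_y; rewrite size_takel // size_drop sz_y; nia.
have [_ injF _] := permF n; apply: injF; rewrite ?inE /=; first exact: szb.
  exact: szb.
exact: Eb.
Qed.

Lemma amplify_permutation : length_permutation (amplify F id k).
Proof.
move=> N; split.
- by move=> z /= <-; apply: amplify_size.
- move=> z z'; rewrite !inE /= => sz sz'; apply: amplify_inj; exact: etrans (esym sz').
(* Surjectivity: an injective self-map of the finite set of words of length [N] is onto. *)
have sz (t : N.-tuple bool) : size (amplify F id k t) == N.
  by rewrite amplify_size size_tuple.
pose f t := Tuple (sz t).
have inj_f : injective f.
  move=> t t' /(congr1 val) E; apply: val_inj; apply: amplify_inj E.
  by rewrite !size_tuple.
move=> z /= /eqP sz_z; exists (invF inj_f (Tuple sz_z)) => /=; first exact: size_tuple.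
by have /(congr1 val) := f_invF inj_f (Tuple sz_z).
Qed.

End LengthPermutation.

(** * Averages over uniform words *)

Import Order.TTheory GRing.Theory Num.Theory.
Local Open Scope ring_scope.

Section Average.
Variable R : realType.
Implicit Types f g : bitseq -> R.

(** The expectation over uniform words of length [N], by recursion on the first bit, so that
    splitting a word into independent parts is a plain induction. *)
Fixpoint avg (N : nat) f : R :=
  if N is N'.+1 then (avg N' (fun w => f (true :: w)) + avg N' (fun w => f (false :: w))) / 2
  else f [::].

Lemma avg_le N f g : (forall w, size w = N -> f w <= g w) -> avg N f <= avg N g.
Proof.
elim: N f g => [|N IH] f g le_fg /=; first exact: le_fg.
by rewrite ler_pM2r ?invr_gt0 ?ltr0n // lerD // IH // => w sz_w; rewrite le_fg //= sz_w.
Qed.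

Lemma eq_avg N f g : (forall w, size w = N -> f w = g w) -> avg N f = avg N g.
Proof. by move=> E; apply/le_anti; rewrite !avg_le // => w sz_w; rewrite E. Qed.

Lemma avg_cst N (c : R) : avg N (fun=> c) = c.
Proof. by elim: N => //= N ->; field. Qed.

Lemma avgD N f g : avg N (fun w => f w + g w) = avg N f + avg N g.
Proof. by elim: N f g => //= N IH f g; rewrite !IH; field. Qed.

Lemma avgZ N (c : R) f : avg N (fun w => c * f w) = c * avg N f.
Proof. by elim: N f => //= N IH f; rewrite !IH; field. Qed.

Lemma avgN N f : avg N (fun w => - f w) = - avg N f.
Proof.
by rewrite -mulN1r -avgZ; apply: eq_avg => w _; rewrite mulN1r.
Qed.

Lemma avg_sum N m (f : nat -> bitseq -> R) :
  avg N (fun w => \sum_(i < m) f i w) = \sum_(i < m) avg N (f i).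
Proof.
elim: m => [|m IH].
  by rewrite big_ord0 -[RHS](avg_cst N); apply: eq_avg => w _; rewrite big_ord0.
rewrite big_ord_recr /= -IH -avgD; apply: eq_avg => w _; exact: big_ord_recr.
Qed.

Lemma avg_cat a b f : avg (a + b) f = avg a (fun u => avg b (fun v => f (u ++ v))).
Proof. by elim: a f => //= a IH f; rewrite !IH. Qed.

Lemma avg_exch a b (f : bitseq -> bitseq -> R) :
  avg a (fun u => avg b (fun v => f u v)) = avg b (fun v => avg a (fun u => f u v)).
Proof.
elim: a f => //= a IH f; rewrite !IH -avgD.
by rewrite mulrC -avgZ; apply: eq_avg => w _; rewrite mulrC.
Qed.

Lemma avg_drop a b f : avg (a + b) (fun z => f (drop a z)) = avg b f.
Proof.
rewrite avg_cat -[RHS](avg_cst a); apply: eq_avg => u sz_u.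
by apply: eq_avg => v _; rewrite drop_size_cat.
Qed.

Lemma avg_take a b f : avg (a + b) (fun z => f (take a z)) = avg a f.
Proof.
rewrite avg_cat; apply: eq_avg => u sz_u; rewrite -[RHS](avg_cst b).
by apply: eq_avg => v _; rewrite take_size_cat.
Qed.

Lemma avg_split a b (f : bitseq -> bitseq -> R) :
  avg (a + b) (fun z => f (take a z) (drop a z)) = avg a (fun u => avg b (f u)).
Proof.
rewrite avg_cat; apply: eq_avg => u sz_u; apply: eq_avg => v _.
by rewrite take_size_cat // drop_size_cat.
Qed.

(** Disjoint blocks of a uniform word are uniform and independent; the last [t] bits average out. *)
Lemma avg_blocks n m t f :
  avg (m * n + t) (fun z => \prod_(i < m) f (block n i z)) = avg n f ^+ m.
Proof.
elim: m => [|m IH].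
  by rewrite expr0 -[RHS](avg_cst (0 * n + t)); apply: eq_avg => w _; rewrite big_ord0.
rewrite mulSn -addnA exprS -IH -avgZ.
pose h u v := f u * \prod_(i < m) f (block n i v).
rewrite (eq_avg (g := fun z => h (take n z) (drop n z))).
  rewrite avg_split avg_exch; apply: eq_avg => v _; rewrite [RHS]mulrC -avgZ.
  by apply: eq_avg => u _; rewrite /h mulrC.
move=> z _; rewrite /h big_ord_recl /block mul0n drop0; congr (_ * _).
by apply: eq_bigr => i _; rewrite drop_drop lift0 mulSn addnC.
Qed.

Lemma sum_avg N f : \sum_(t : N.-tuple bool) f t = 2 ^+ N * avg N f.
Proof.
elim: N f => [|N IH] f.
  rewrite mul1r (bigD1 [tuple]) //= big1 ?addr0 // => t.
  by move=> /eqP[]; apply: tuple0.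
pose h (p : bool * N.-tuple bool) : N.+1.-tuple bool := [tuple of p.1 :: p.2].
rewrite (reindex h) /=; last first.
  exists (fun t => (thead t, [tuple of behead t])) => [[b t] _|t _].
    by rewrite /h theadE; congr (_, _); apply: val_inj.
  by rewrite [RHS]tuple_eta.
rewrite -(pair_bigA _ (fun (b : bool) (t : N.-tuple bool) => f (b :: t))) /= big_bool /=.
rewrite (IH (fun w => f (true :: w))) (IH (fun w => f (false :: w))) exprS.
by field.
Qed.

Lemma challenge_avg F (q : {poly nat}) n (E : pred (bitseq * bitseq * bitseq)) :
  challenge_prob R F q n E =
  avg n (fun x => avg q.[n] (fun r => (E (ones n, F x, r))%:R)).
Proof.
rewrite /challenge_prob /equiprobability card_prod !card_tuple card_bool natrM !natrX.
rewrite -sum1_card natr_sum big_mkcond /=.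
rewrite (eq_bigr (fun xr : n.-tuple bool * q.[n].-tuple bool =>
  (E (ones n, F xr.1, tval xr.2))%:R : R)); last by move=> xr _; rewrite inE; case: (E _).
rewrite -(pair_bigA _ (fun (x : n.-tuple bool) (r : q.[n].-tuple bool) =>
  (E (ones n, F x, tval r))%:R)) /=.
under eq_bigr do rewrite (sum_avg _ (fun r => (E (ones n, F _, r))%:R)).
rewrite -mulr_sumr (sum_avg n (fun x => avg q.[n] (fun r => (E (ones n, F x, r))%:R))).
by field; rewrite !expf_neq0 ?pnatr_eq0.
Qed.

End Average.

(** * Success probabilities of the two inverters *)

Section Reduction.
Variable R : realType.

(** Overwriting a block of a uniform word with an independent uniform block does not change its
    law. *)
Lemma avg_resample n i b (f : bitseq -> R) :
  avg (i * n + (n + b)) f =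
  avg n (fun x => avg (i * n + (n + b)) (fun z => f (repl n i x z))).
Proof.
rewrite avg_cat (eq_avg (g := fun u => avg n (fun x => avg b (fun w => f (u ++ x ++ w))))).
  rewrite avg_exch; apply: eq_avg => x sz_x; rewrite avg_cat; apply: eq_avg => u sz_u.
  rewrite avg_cat -[LHS](avg_cst n); apply: eq_avg => v sz_v; apply: eq_avg => w _.
  by rewrite /repl take_size_cat // addnC -drop_drop !drop_size_cat.
by move=> u _; rewrite avg_cat; apply: eq_avg => x _; apply: eq_avg => w _.
Qed.

Lemma avg01 N (f : bitseq -> R) : (forall w, size w = N -> 0 <= f w <= 1) -> 0 <= avg N f <= 1.
Proof.
move=> H; apply/andP; split.
  by rewrite -(avg_cst N (0 : R)); apply: avg_le => w /H /andP[].
by rewrite -[X in _ <= X](avg_cst N (1 : R)); apply: avg_le => w /H /andP[].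
Qed.

Section Hardness.
Variables (n m N : nat) (W : bitseq -> R) (eps : R).
Hypotheses (le_N : (m * n <= N)%N) (W01 : forall z, 0 <= W z <= 1) (eps_ge0 : 0 <= eps).

Definition hit i x := avg N (fun z => W (repl n i x z)).
Definition bad x := all (fun i => hit i x <= eps) (iota 0 m).

(** Pointwise, [W z] is at most the indicator that no block is bad plus the sum of [W z] over the
    bad positions. The indicator is a product over independent blocks; for each position, resampling
    its block turns the average into one of [hit i x] over the bad [x], at most [eps]. *)
Lemma hardness : avg N W <= (1 - avg n (fun x => (bad x)%:R)) ^+ m + m%:R * eps.
Proof.
set beta := avg n _.
apply: le_trans (_ : avg N (fun z => \prod_(i < m) (1 - (bad (block n i z))%:R) +
   \sum_(i < m) (bad (block n i z))%:R * W z) <= _).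
  apply: avg_le => z _; have /andP[W_ge0 W_le1] := W01 z.
  case: (boolP [exists i : 'I_m, bad (block n i z)]) => [/existsP[i Bi]|].
    rewrite (bigD1 i) //= [X in _ <= _ + X](bigD1 i) //= Bi subrr mul0r add0r mul1r.
    by rewrite lerDl sumr_ge0 // => j _; rewrite mulr_ge0.
  rewrite negb_exists => /forallP nB.
  rewrite big1 => [|i _]; last by rewrite (negPf (nB i)) subr0.
  by rewrite big1 ?addr0 // => i _; rewrite (negPf (nB i)) mul0r.
rewrite avgD; apply: lerD.
  rewrite -(subnKC le_N) (avg_blocks n m (N - m * n) (fun x => 1 - (bad x)%:R)).
  by rewrite avgD avgN avg_cst.
rewrite (avg_sum N m (fun i z => (bad (block n i z))%:R * W z)).
apply: le_trans (_ : \sum_(i < m) eps <= _); last first.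
  by rewrite sumr_const card_ord mulr_natl.
apply: ler_sum => i _.
have EN : N = (i * n + (n + (N - i * n - n)))%N by have := ltn_ord i; nia.
rewrite EN avg_resample -EN -[X in _ <= X](avg_cst n); apply: avg_le => x sz_x.
rewrite (eq_avg (g := fun z => (bad x)%:R * W (repl n i x z))); last first.
  move=> z sz_z; rewrite (block_repl _ (ltn_ord i)) ?eqxx // sz_z; lia.
rewrite avgZ -/(hit i x); case: (boolP (bad x)) => [/allP/(_ (val i))|_].
  by rewrite mem_iota ltn_ord mul1r; apply.
by rewrite mul0r.
Qed.

End Hardness.

Variables (F e : bitseq -> bitseq) (k : nat) (q : {poly nat})
  (G : bitseq * bitseq * bitseq -> option bitseq) (d : nat) (q' : {poly nat}).
Hypothesis dec : decodable F e.
Variables (n t : nat) (eps : R).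
Let N := (n ^ k.+2 + t)%N.
Hypotheses (rootN : kroot k.+2 N = n) (lt_t : (t < tails k n)%N).
Hypothesis le_q' :
  (n ^ k.+1 * tails k n * rounds d n * chunk k q n <= q'.[n])%N.
Hypotheses (eps_ge0 : 0 <= eps) (eps_le1 : eps <= 1).

Let H := amplify F e k.
Let W z : R := avg q.[N] (fun rho => (inverts H G (ones N, H z, rho))%:R).
Let L := chunk k q n.

Lemma chunk_ge : (N + q.[N] <= L)%N.
Proof.
have le_N : (N <= n ^ k.+2 + tails k n)%N by rewrite leq_add2l ltnW.
by rewrite /L /chunk leq_add //; apply: horner_mono.
Qed.

Lemma round_success i x : avg L (fun rho =>
    (inverts H G (ones N, H (repl n i x (take N rho)), take q.[N] (drop N rho)))%:R) =
  hit n N W i x.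
Proof.
have EL : L = (N + (q.[N] + (L - N - q.[N])))%N by have := chunk_ge; lia.
pose h u v : R := (inverts H G (ones N, H (repl n i x u), take q.[N] v))%:R.
rewrite EL (avg_split N (q.[N] + (L - N - q.[N])) h); apply: eq_avg => u _.
by rewrite (avg_take _ _ (fun v => (inverts H G (ones N, H (repl n i x u), v))%:R)).
Qed.

(** If the inverter fails, then so do all the rounds for the position [i] and the tail length [t];
    they use disjoint chunks, hence are independent. *)
Lemma inverter_fail i x : size x = n -> (i < n ^ k.+1)%N ->
  avg q'.[n] (fun r => (~~ inverts F (inverter F e k q G d) (ones n, F x, r))%:R) <=
  (1 - hit n N W i x) ^+ rounds d n.
Proof.
move=> sz_x lt_i; set S := rounds d n.
(* The chunks of these rounds are contiguous: they are the blocks of length [L] from [off] on. *)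
pose off := ((i * tails k n + t) * S * L)%N.
pose v rho : R := 1 -
  (inverts H G (ones N, H (repl n i x (take N rho)), take q.[N] (drop N rho)))%:R.
have le_off : (off + S * L <= q'.[n])%N.
  apply: leq_trans le_q'; rewrite /off -/L -/S -mulnDl leq_mul2r; apply/orP; right.
  by rewrite -mulSnr leq_mul2r; apply/orP; right; nia.
have Eq' : q'.[n] = (off + (S * L + (q'.[n] - off - S * L)))%N by lia.
have -> : (1 - hit n N W i x) ^+ S =
    avg q'.[n] (fun r => \prod_(s < S) v (block L s (drop off r))).
  rewrite [in RHS]Eq' (avg_drop _ _ (fun r => \prod_(s < S) v (block L s r))).
  by rewrite avg_blocks /v avgD avgN avg_cst round_success.
apply: avg_le => r sz_r; case: (boolP (inverts F _ _)) => [_|Hr] /=.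
  apply: prodr_ge0 => s _; rewrite /v subr_ge0 lern1; exact: leq_b1.
rewrite big1 // => s _; rewrite /v.
have := inverterP sz_x Hr lt_i lt_t (ltn_ord s).
case: (boolP (inverts H _ _)) => [Hs|]; last by rewrite subr0.
suff E : inverts H G (ones N, H (repl n i x (take N (drop (s * L) (drop off r)))),
    take q.[N] (drop N (drop (s * L) (drop off r)))).
  move=> Et; exfalso; move: Et; apply: trial_success => //; rewrite -/N -/L -/S.
    by rewrite size_drop sz_r; have := chunk_ge; have := ltn_ord s; nia.
  by rewrite mulnDl addnC -drop_drop.
move: Hs; rewrite /block; set y := drop (s * L) _.
rewrite take_takel ?(leq_trans (leq_addr _ _) chunk_ge) //.
have -> : drop N (take L y) = take (L - N) (drop N y).
  by rewrite take_drop subnK // (leq_trans (leq_addr _ _) chunk_ge).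
by rewrite take_takel // leq_subRL ?chunk_ge // (leq_trans (leq_addr _ _) chunk_ge).
Qed.

Lemma reduction : exists beta : R, [/\ 0 <= beta <= 1,
  challenge_prob R H q N (inverts H G) <=
    (1 - beta) ^+ (n ^ k.+1)%N + (n ^ k.+1)%:R * eps &
  (1 - beta) * (1 - (1 - eps) ^+ rounds d n) <=
    challenge_prob R F q' n (inverts F (inverter F e k q G d))].
Proof.
pose B x := bad n (n ^ k.+1) N W eps x.
have W01 z : 0 <= W z <= 1 by apply: avg01 => w _; rewrite ler0n lern1 leq_b1.
exists (avg n (fun x => (B x)%:R)); split.
- by apply: avg01 => w _; rewrite ler0n lern1 leq_b1.
- rewrite challenge_avg; apply: hardness => //.
  by rewrite -[X in (_ <= X)%N]/N -rootN kroot_blocks.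
- rewrite challenge_avg; set T := 1 - _ ^+ _.
  have T_ge0 : 0 <= T.
    by rewrite subr_ge0 exprn_ile1 // ?subr_ge0 // gerBl.
  have -> : (1 - avg n (fun x => (B x)%:R)) * T = avg n (fun x => T * (1 - (B x)%:R)).
    by rewrite avgZ avgD avgN avg_cst mulrC.
  apply: avg_le => x sz_x; case: (boolP (B x)) => [_|/allPn[i]].
    rewrite subrr mulr0.
    by rewrite -[X in X <= _](avg_cst q'.[n] (0 : R)); apply: avg_le => r _; apply: ler0n.
  (* As [x] is not bad, one position is hit with probability above [eps], and its rounds alone
     suffice. *)
  rewrite mem_iota => /andP[_ lt_i]; rewrite -ltNge => lt_eps.
  rewrite subr0 mulr1.
  have -> : avg q'.[n] (fun r => (inverts F (inverter F e k q G d) (ones n, F x, r))%:R) =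
      1 - avg q'.[n] (fun r => (~~ inverts F (inverter F e k q G d) (ones n, F x, r))%:R) :> R.
    rewrite -avgN -[X in X + _](avg_cst q'.[n] (1 : R)) -avgD; apply: eq_avg => r _.
    by case: (inverts _ _ _); rewrite ?subr0 ?subrr.
  rewrite lerD2l lerN2; apply: le_trans (inverter_fail sz_x lt_i) _.
  apply: lerXn2r; rewrite ?nnegrE ?subr_ge0 //; last by rewrite lerD2l lerN2 ltW.
  by have /andP[] := avg01 (N := N) (fun z _ => W01 (repl n i x z)).
Qed.

End Reduction.

(** * Asymptotics *)

Section Asymptotics.
Variable R : realType.

(** With [c = 2 * d.+1], the exponential is the power [d.+1] of that of [n / c], hence at least
    [(n / c) ^+ d.+1], which exceeds [2 * n ^+ d] once [n >= 2 * c ^ d.+1]. *)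
Lemma expR_ge_poly (d : nat) : exists n0 : nat, forall n, (n0 <= n)%N ->
  2 * n%:R ^+ d <= expR (n%:R / 2) :> R.
Proof.
pose c := (2 * d.+1)%N; have c_gt0 : 0 < c%:R :> R by rewrite ltr0n.
exists (2 * c ^ d.+1)%N => n le_n.
have -> : n%:R / 2 = d.+1%:R * (n%:R / c%:R) :> R.
  rewrite /c natrM; have : d.+1%:R != 0 :> R by rewrite pnatr_eq0.
  by move: d.+1%:R => y y0; field.
rewrite expRM_natl; apply: le_trans (_ : (n%:R / c%:R) ^+ d.+1 <= _); last first.
  apply: lerXn2r; rewrite ?nnegrE ?expR_ge0 ?divr_ge0 ?ler0n //.
  by apply: le_trans (expR_ge1Dx _); rewrite lerDr.
rewrite exprMn exprVn ler_pdivlMr ?exprn_gt0 // [n%:R ^+ d.+1]exprS mulrAC.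
rewrite ler_wpM2r ?exprn_ge0 //.
by rewrite -natrX -natrM ler_nat.
Qed.

Lemma expn_le_expRV (x : R) (m n : nat) : 0 <= x <= 1 -> n%:R / 2 <= m%:R * x ->
  (1 - x) ^+ m <= (expR (n%:R / 2))^-1.
Proof.
move=> /andP[x_ge0 x_le1] le_n; apply: le_trans (_ : expR (- x) ^+ m <= _).
  by apply: lerXn2r; rewrite ?nnegrE ?expR_ge0 ?subr_ge0 // expR_ge1Dx.
by rewrite -expRM_natl -expRN ler_expR mulrN lerN2.
Qed.

(** The choice of [eps] makes the second term exactly half of the target. The number of rounds is at
    least [n / 2] times the inverse of [eps], so all rounds fail with probability at most
    [expR (- n / 2)]. This gives [beta] at least half of [n ^- k], and the [n ^ k.+1] blocks make
    the first term at most [expR (- n / 2)] too. *)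
Lemma weak_to_strong_bound (k D : nat) : exists n0 : nat, forall (n : nat) (beta : R),
  (n0 <= n)%N -> (0 < n)%N -> 0 <= beta <= 1 ->
  let eps := (2 * n%:R ^+ (D + k.+1))^-1 in
  (1 - beta) * (1 - (1 - eps) ^+ rounds (D + k.+2) n) <= 1 - (n%:R ^+ k)^-1 ->
  (1 - beta) ^+ (n ^ k.+1)%N + (n ^ k.+1)%:R * eps <= (n%:R ^+ D)^-1.
Proof.
have [n0 Hn0] := expR_ge_poly (k + D); exists n0 => n beta le_n n_gt0 beta01 eps.
have x_gt0 : 0 < n%:R :> R by rewrite ltr0n.
have x_ge1 : 1 <= n%:R :> R by rewrite ler1n.
have X_gt0 j : 0 < n%:R ^+ j :> R by rewrite exprn_gt0.
have X_ge1 j : 1 <= n%:R ^+ j :> R by rewrite exprn_ege1.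
have expV j : (j <= k + D)%N -> (expR (n%:R / 2))^-1 <= (2 * n%:R ^+ j)^-1 :> R.
  move=> le_j; rewrite lef_pV2 ?posrE ?expR_gt0 ?mulr_gt0 ?ltr0n //.
  by apply: le_trans (Hn0 n le_n); rewrite ler_pM2l ?ltr0n // ler_weXn2l.
have eps01 : 0 <= eps <= 1.
  have := X_ge1 (D + k.+1)%N => X1.
  by apply/andP; split; rewrite /eps ?invr_ge0 ?invf_le1; lra.
have eta : (1 - eps) ^+ rounds (D + k.+2) n <= (2 * n%:R ^+ k)^-1.
  apply: le_trans (expV _ (leq_addr _ _)); apply: expn_le_expRV => //.
  rewrite /eps ler_pdivlMr ?mulr_gt0 // /rounds.
  have -> : n%:R / 2 * (2 * n%:R ^+ (D + k.+1)) = n%:R ^+ (D + k.+2) :> R.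
    by rewrite [(D + k.+2)%N]addnS exprS; field.
  by rewrite -natrX ler_nat leq_expl.
set y := (1 - eps) ^+ _ in eta *; set z := _^-1 => Hy.
have y_ge0 : 0 <= y by rewrite exprn_ge0 // subr_ge0; case/andP: eps01.
have z2 : (2 * n%:R ^+ k)^-1 = z / 2 by rewrite invfM mulrC.
(* Expanding [(1 - beta) * (1 - y) <= 1 - z] gives [beta >= z - y + beta * y], where [y] is at most
   [z / 2]. *)
have le_beta : z / 2 <= beta.
  have : 0 <= beta * y by rewrite mulr_ge0 //; case/andP: beta01.
  by rewrite z2 in eta; move: Hy eta; lra.
have -> : (n%:R ^+ D)^-1 = (2 * n%:R ^+ D)^-1 + (n ^ k.+1)%:R * eps.
  rewrite /eps natrX exprD; field.
  by rewrite !lt0r_neq0.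
rewrite lerD2r; apply: le_trans (expV _ (leq_addl _ _)); apply: expn_le_expRV => //.
apply: le_trans (_ : (n ^ k.+1)%:R * (z / 2) <= _); last by rewrite ler_pM2l // natrX.
rewrite natrX exprS /z; have := lt0r_neq0 (X_gt0 k); move: (n%:R ^+ k) => u u0.
by rewrite [X in _ <= X](_ : _ = n%:R / 2) //; field.
Qed.

Lemma natr_powRN (n : nat) (c : R) (j : nat) : (0 < n)%N -> c <= j%:R ->
  (n%:R ^+ j)^-1 <= n%:R `^ (- c).
Proof.
move=> n_gt0 le_c; rewrite -powR_mulrn ?ler0n // -powRN.
by apply: ler_powR; rewrite ?ler1n // lerN2.
Qed.

Lemma amplification F e : PT (e : seq bool -> seq bool) -> decodable F e ->
  weakly_one_way R F -> exists k, strongly_one_way R (amplify F e k).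
Proof.
move=> Pe dec [polyF [c [c_gt0 weakF]]]; have PF := PT_poly_time polyF.
pose k := Num.bound c; have le_ck : c <= k%:R by apply/ltW/archi_boundP/ltW.
exists k; split; first exact/poly_time_PT/PT_amplify.
move=> c' c'_gt0 q G0 pptG0; have [G PG EG] := PT_ppt pptG0.
pose C := Num.bound c'; have le_cC : c' <= C%:R by apply/ltW/archi_boundP/ltW.
(* For [n >= 2], [N < n.+1 ^ k.+2 <= n ^ (2 * k.+2)], hence [N ^ C <= n ^ D]. *)
pose D := (2 * (k.+2 * C))%N; pose d := (D + k.+2)%N.
pose need n := (n ^ k.+1 * tails k n * rounds d n * chunk k q n)%N.
have [l Hl] : exists l, forall n, (need n <= pb l n)%N.
  have Pneed : PT need.
    apply: PT_muln; last by apply: PT_chunk; pt.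
    apply: PT_muln; last by apply: PT_expn; apply: PT_succn; pt.
    apply: PT_muln; apply: PT_expn; [exact: PT_id|exact/PT_succn/PT_id].
  by have [l Hl] := PT_bound Pneed; exists l => n; have := Hl n; rewrite !wt_nat.
(* A polynomial that bounds the number of random bits needed is enough, the excess being ignored. *)
have [q' Hq'] := pb_polyP l.
have {}weakF := weakF q' _ (ppt_PT q' (PT_inverter k q d PF Pe PG)).
case: weakF => n1 _ weakF; have [n0 Hn0] := weak_to_strong_bound k D.
(* From [M ^ k.+2] on, the root of the length is at least [M], so the thresholds for [n] become one
   for [N]. *)
pose M := maxn n1 (maxn n0 2); exists (M ^ k.+2)%N => // N /= le_N.
set n := kroot k.+2 N; have /andP[le_nN lt_Nn] := krootP N (isT : (0 < k.+2)%N).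
rewrite -/n in le_nN lt_Nn.
have le_Mn : (M <= n)%N.
  by rewrite -ltnS -(ltn_exp2r _ _ (isT : (0 < k.+2)%N)); apply: leq_ltn_trans lt_Nn.
have [le_n1 le_n0 le_2n] : [/\ n1 <= n, n0 <= n & 2 <= n]%N.
  by move: le_Mn; rewrite !geq_max => /and3P.
have n_gt0 : (0 < n)%N by apply: leq_trans le_2n.
pose t := (N - n ^ k.+2)%N; have EN : (n ^ k.+2 + t)%N = N by rewrite subnKC.
pose eps : R := (2 * n%:R ^+ (D + k.+1))^-1.
have X_ge1 : 1 <= n%:R ^+ (D + k.+1) :> R by rewrite exprn_ege1 ?ler1n.
have eps_ge0 : 0 <= eps by rewrite invr_ge0; lra.
have eps_le1 : eps <= 1 by rewrite /eps invf_le1; lra.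
have lt_t : (t < tails k n)%N by apply: leq_ltn_trans (leq_subr _ _) lt_Nn.
have le_q' : (need n <= q'.[n])%N by rewrite Hq'.
have [] := @reduction R F e k q G d q' dec n t eps _ lt_t le_q' eps_ge0 eps_le1.
  by rewrite EN.
rewrite EN => beta [beta01 alpha_le sigma_ge].
have -> : challenge_prob R (amplify F e k) q N (inverts (amplify F e k) G0) =
    challenge_prob R (amplify F e k) q N (inverts (amplify F e k) G).
  rewrite !challenge_avg; apply: eq_avg => x sz_x; apply: eq_avg => r sz_r.
  by rewrite /inverts /= EG.
apply: le_trans alpha_le _; apply: le_trans (_ : (n%:R ^+ D)^-1 <= _).
  apply: Hn0 => //; apply: le_trans sigma_ge _; apply: le_trans (weakF n le_n1) _.
  by rewrite lerD2l lerN2 natr_powRN.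
have N_gt0 : (0 < N)%N by apply: leq_trans le_nN; rewrite expn_gt0 n_gt0.
apply: le_trans (natr_powRN N_gt0 le_cC).
rewrite lef_pV2 ?posrE ?exprn_gt0 ?ltr0n // -!natrX ler_nat.
rewrite /D !expnM; apply: leq_expl; apply: leq_trans (ltnW lt_Nn) _.
by apply: leq_expl; rewrite expnS expn1; nia.
Qed.

End Asymptotics.

Theorem corollary5p2 (R : realType) :
  ((exists F : bitseq -> bitseq, weakly_one_way R F) ->
   (exists F : bitseq -> bitseq, strongly_one_way R F))
  /\
  ((exists F : bitseq -> bitseq, weakly_one_way_permutation R F) ->
   (exists F : bitseq -> bitseq, strongly_one_way_permutation R F)).
Proof.
split=> [[F weakF]|[F [weakF permF]]].
  have [k strongF] := amplification PT_delimit (@delimit_decodable F) weakF.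
  by exists (amplify F delimit k).
have [k strongF] := amplification (PT_id word_enc) (id_decodable permF) weakF.
by exists (amplify F id k); split=> //; apply: amplify_permutation.
Qed.
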